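(* Let $Q$ be a finite ordered quiver with tensor relations $R$, and let $D(Q)$ be the bounded derived category of $(Q,R)\text{-Rep}$ with its vertex-wise tensor product. For each vertex $n\in Q_0$ let $P_n$ be the full subcategory of $D(Q)$ consisting of the objects $V$ with $H(V)_n=0$. Then $\mathrm{Spc}\, D(Q)$ is the discrete space $\{P_n \mid n\in Q_0\}$.
   Context: Fix a field $k$. A quiver $Q$ has vertex set $Q_0$ and arrow set $Q_1$. It is finite ordered if it has finitely many vertices and arrows and no oriented cycles. $Q\text{-Rep}$ is the abelian category of finite-dimensional representations of $Q$ over $k$; $V_v$ denotes the vector space of $V$ at the vertex $v$. For a set (ideal) of relations $R\subseteq kQ$, $(Q,R)\text{-Rep}$ is the full subcategory of representations on which all elements of $R$ act as zero. The vertex-wise tensor product is $(V\otimes W)_v=V_v\otimes_k W_v$, each arrow acting by the tensor product of its two actions; its unit object $U$ has $U_v=k$ for all $v$ and all arrows acting as the identity. $R$ consists of tensor relations if its elements involve only non-trivial paths, $U\in (Q,R)\text{-Rep}$, and $(Q,R)\text{-Rep}$ is closed under $\otimes$. $D(Q):=D^b((Q,R)\text{-Rep})$ is then a tensor triangulated category. For $V\in D(Q)$, $H(V)=\bigoplus_i H^i(V)$ is the total cohomology and $H(V)_n$ is the graded vector space of $H(V)$ at the vertex $n$. A tensor ideal of a tensor triangulated category $T$ is a full, thick, triangulated subcategory $J$ with $V\otimes W\in J$ for all $V\in J$, $W\in T$. A proper tensor ideal $P$ is prime if $V\otimes W\in P$ implies $V\in P$ or $W\in P$. $\mathrm{Spc}\,T$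 is the set of prime tensor ideals of $T$, with the topology whose closed sets are the sets $\mathbf Z(S)=\{P\in\mathrm{Spc}\,T \mid S\cap P=\emptyset\}$ for $S$ a set of objects of $T$. *)

(* Defs.v *)
From HB Require Import structures.
From mathcomp Require Import all_boot all_order all_algebra finmap zify.
From mathcomp Require Import boolp classical_sets.

Set Implicit Arguments.
Unset Strict Implicit.
Unset Printing Implicit Defensive.

Import GRing.Theory.

Local Open Scope ring_scope.

Section LinfunE.
Variables (k : fieldType) (V W : vectType k).

Lemma linfunE (f : V -> W) : linear f -> linfun f =1 f.
Proof.
move=> f_lin; pose fL := GRing.isLinear.Build _ _ _ _ f f_lin.
pose F : {linear V -> W} := HB.pack f fL.
exact: (lfunE F).
Qed.

End LinfunE.

Section TensorProduct.
Variable k : fieldType.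
Implicit Types V W : vectType k.

(* For finite-dimensional V, the tensor product V ⊗ W is Hom(V^*, W), the pure
   tensor v ⊗ w being phi |-> phi(v) w; dually, f ⊗ g is T |-> g \o T \o f^*. *)
Definition dual V : vectType k := 'Hom(V, k^o).
Definition tens V W : vectType k := 'Hom(dual V, W).

Definition dualf V V' (f : 'Hom(V, V')) : 'Hom(dual V', dual V) :=
  linfun (fun phi : 'Hom(V', k^o) => (phi \o f)%VF).

Definition ptens V W (v : V) (w : W) : tens V W :=
  linfun (fun phi : dual V => phi v *: w).

Definition tensf V V' W W' (f : 'Hom(V, V')) (g : 'Hom(W, W')) :
    'Hom(tens V W, tens V' W') :=
  linfun (fun t : 'Hom(dual V, W) => (g \o t \o dualf f)%VF).

Lemma dualfE V V' (f : 'Hom(V, V')) (phi : dual V') :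
  dualf f phi = (phi \o f)%VF.
Proof.
apply: (linfunE (V := dual V') (W := dual V)) => c a b.
by rewrite comp_lfunDl -comp_lfunZl.
Qed.

Lemma ptensE V W (v : V) (w : W) (phi : dual V) :
  ptens v w phi = (phi v : k) *: w.
Proof.
by apply: linfunE => c a b; rewrite add_lfunE scale_lfunE scalerDl scalerA.
Qed.

Lemma tensfE V V' W W' (f : 'Hom(V, V')) (g : 'Hom(W, W')) (t : tens V W) :
  tensf f g t = (g \o t \o dualf f)%VF.
Proof.
apply: (linfunE (V := tens V W) (W := tens V' W')) => c a b.
by rewrite comp_lfunDr comp_lfunDl -comp_lfunZr -comp_lfunZl.
Qed.

Lemma tensf_ptens V V' W W' (f : 'Hom(V, V')) (g : 'Hom(W, W')) v w :
  tensf f g (ptens v w) = ptens (f v) (g w).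
Proof.
apply/lfunP=> phi; rewrite tensfE !comp_lfunE !ptensE dualfE linearZ /=.
by rewrite comp_lfunE.
Qed.

Lemma dim_tens V W : \dim {: tens V W} = (\dim {: V} * \dim {: W})%N.
Proof. by rewrite !dimvf /dim /= /dim /= muln1. Qed.

Lemma tensf_comp V V' V'' W W' W'' (f : 'Hom(V, V')) (f' : 'Hom(V', V''))
    (g : 'Hom(W, W')) (g' : 'Hom(W', W'')) :
  tensf (f' \o f)%VF (g' \o g)%VF = (tensf f' g' \o tensf f g)%VF.
Proof.
apply/lfunP=> t; apply/lfunP=> phi.
by rewrite comp_lfunE !tensfE !comp_lfunE !dualfE comp_lfunA.
Qed.

Lemma tensfDl V V' W W' (f f' : 'Hom(V, V')) (g : 'Hom(W, W')) :
  tensf (f + f') g = tensf f g + tensf f' g.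
Proof.
apply/lfunP=> t; apply/lfunP=> phi; rewrite !add_lfunE !tensfE.
by rewrite !comp_lfunE !dualfE comp_lfunDr !linearD.
Qed.

Lemma tensfDr V V' W W' (f : 'Hom(V, V')) (g g' : 'Hom(W, W')) :
  tensf f (g + g') = tensf f g + tensf f g'.
Proof.
apply/lfunP=> t; apply/lfunP=> phi; rewrite !add_lfunE !tensfE.
by rewrite !comp_lfunE add_lfunE.
Qed.

Lemma tensfZl V V' W W' c (f : 'Hom(V, V')) (g : 'Hom(W, W')) :
  tensf (c *: f) g = c *: tensf f g.
Proof.
apply/lfunP=> t; apply/lfunP=> phi; rewrite !scale_lfunE !tensfE.
by rewrite !comp_lfunE !dualfE -comp_lfunZr !linearZ.
Qed.

Lemma tensfZr V V' W W' c (f : 'Hom(V, V')) (g : 'Hom(W, W')) :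
  tensf f (c *: g) = c *: tensf f g.
Proof.
apply/lfunP=> t; apply/lfunP=> phi; rewrite !scale_lfunE !tensfE.
by rewrite !comp_lfunE scale_lfunE.
Qed.

End TensorProduct.

Section DirectSum.
Variables (k : fieldType) (V W : vectType k).

Definition dsum : vectType k := (V * W)%type.
Definition dinl : 'Hom(V, dsum) := linfun (fun v => (v, 0) : dsum).
Definition dinr : 'Hom(W, dsum) := linfun (fun w => (0, w) : dsum).
Definition dfst : 'Hom(dsum, V) := linfun (fun u : dsum => u.1).
Definition dsnd : 'Hom(dsum, W) := linfun (fun u : dsum => u.2).

Lemma dinlE v : dinl v = (v, 0).
Proof.
by apply: linfunE => c a b; apply/eqP; rewrite xpair_eqE /= scaler0 addr0 !eqxx.
Qed.

Lemma dinrE w : dinr w = (0, w).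
Proof.
by apply: linfunE => c a b; apply/eqP; rewrite xpair_eqE /= scaler0 addr0 !eqxx.
Qed.

Lemma dfstE u : dfst u = u.1. Proof. exact: linfunE. Qed.

Lemma dsndE u : dsnd u = u.2. Proof. exact: linfunE. Qed.

End DirectSum.

Record quiver := Quiver {
  vert : finType;
  arr : finType;
  src : arr -> vert;
  tgt : arr -> vert }.

Section Paths.
Variable Q : quiver.

Fixpoint walk (x : vert Q) (s : seq (arr Q)) : bool :=
  if s is a :: s' then (src a == x) && walk (tgt a) s' else true.

Definition walk_end (x : vert Q) (s : seq (arr Q)) : vert Q :=
  last x [seq tgt a | a <- s].

Definition ordered_quiver : Prop :=
  forall x s, walk x s -> s != [::] -> walk_end x s != x.

(* A path is a starting vertex together with a composable list of arrows in
   the order in which they are traversed; trivial paths have no arrow. *)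
Definition qpath : choiceType := {p : vert Q * seq (arr Q) | walk p.1 p.2}.

Definition nontrivial (p : qpath) : bool := (val p).2 != [::].

End Paths.

(* The underlying vector space of kQ, with the paths as a basis. *)
Definition pathalg (Q : quiver) (k : fieldType) := {fsfun qpath Q -> k with 0}.

(* The identity of F i if i = j, and 0 otherwise. *)
Definition transp (k : fieldType) (I : eqType) (F : I -> vectType k) (i j : I) :
    'Hom(F i, F j) :=
  if i =P j is ReflectT e then ecast z ('Hom(F i, F z)) e \1%VF else 0.

Section Rep.
Variables (Q : quiver) (k : fieldType).

Record rep := Rep {
  rsp :> vert Q -> vectType k;
  rarr : forall a : arr Q, 'Hom(rsp (src a), rsp (tgt a)) }.

Fixpoint walk_act (V : rep) (x : vert Q) (s : seq (arr Q)) (y : vert Q) :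
    'Hom(V x, V y) :=
  if s is a :: s' then
    (walk_act V (tgt a) s' y \o rarr V a \o transp V x (src a))%VF
  else transp V x y.

(* The component V_x -> V_y of the action of r on the direct sum of the spaces
   of V; a path acts as 0 on V_x unless it starts at x, and its image lies in
   the space at its end. *)
Definition act (V : rep) (r : pathalg Q k) (x y : vert Q) : 'Hom(V x, V y) :=
  \sum_(p <- finsupp r)
     r p *: (walk_act V (val p).1 (val p).2 y \o transp V x (val p).1)%VF.

Definition satisfies (R : set (pathalg Q k)) (V : rep) : Prop :=
  forall r, R r -> forall x y, act V r x y = 0.

Record rhom (V W : rep) := RHom {
  rfun :> forall x, 'Hom(V x, W x);
  rfunP : forall a,
    (rarr W a \o rfun (src a))%VF = (rfun (tgt a) \o rarr V a)%VF }.

Lemma rhomP V W (f g : rhom V W) : f = g <-> forall x, f x = g x.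
Proof.
split=> [-> // |]; case: f g => [f fP] [g gP] /= fg.
have {}fg : f = g by apply: functional_extensionality_dep.
by rewrite fg in fP *; congr RHom; apply: Prop_irrelevance.
Qed.

HB.instance Definition _ V W := gen_eqMixin (rhom V W).
HB.instance Definition _ V W := gen_choiceMixin (rhom V W).

Section Ops.
Variables V W : rep.
Implicit Types f g : rhom V W.

Program Definition rzeroh : rhom V W := @RHom V W (fun x => 0) _.
Next Obligation. by rewrite comp_lfun0r comp_lfun0l. Qed.

Program Definition radd f g := @RHom V W (fun x => f x + g x) _.
Next Obligation. by rewrite comp_lfunDr comp_lfunDl !rfunP. Qed.

Program Definition ropp f := @RHom V W (fun x => - f x) _.
Next Obligation. by rewrite comp_lfunNr comp_lfunNl rfunP. Qed.

Program Definition rscale (c : k) f := @RHom V W (fun x => c *: f x) _.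
Next Obligation. by rewrite -comp_lfunZr -comp_lfunZl rfunP. Qed.

Lemma raddA : associative radd.
Proof. by move=> f g h; apply/rhomP=> x /=; rewrite addrA. Qed.
Lemma raddC : commutative radd.
Proof. by move=> f g; apply/rhomP=> x /=; rewrite addrC. Qed.
Lemma radd0 : left_id rzeroh radd.
Proof. by move=> f; apply/rhomP=> x /=; rewrite add0r. Qed.
Lemma raddN : left_inverse rzeroh ropp radd.
Proof. by move=> f; apply/rhomP=> x /=; rewrite addNr. Qed.

HB.instance Definition _ := GRing.isZmodule.Build (rhom V W) raddA raddC radd0 raddN.

Lemma rscaleA a b f : rscale a (rscale b f) = rscale (a * b) f.
Proof. by apply/rhomP=> x /=; rewrite scalerA. Qed.
Lemma rscale1 : left_id 1 rscale.
Proof. by move=> f; apply/rhomP=> x /=; rewrite scale1r. Qed.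
Lemma rscaleDr : right_distributive rscale +%R.
Proof. by move=> c f g; apply/rhomP=> x /=; rewrite scalerDr. Qed.
Lemma rscaleDl f : {morph rscale^~ f : a b / a + b}.
Proof. by move=> a b; apply/rhomP=> x /=; rewrite scalerDl. Qed.

HB.instance Definition _ :=
  GRing.Zmodule_isLmodule.Build k (rhom V W) rscaleA rscale1 rscaleDr rscaleDl.

End Ops.

Program Definition ridh V : rhom V V := @RHom V V (fun x => \1%VF) _.
Next Obligation. by rewrite comp_lfun1l comp_lfun1r. Qed.

Program Definition rcomp V W X (g : rhom W X) (f : rhom V W) : rhom V X :=
  @RHom V X (fun x => (g x \o f x)%VF) _.
Next Obligation. by rewrite comp_lfunA rfunP -comp_lfunA rfunP comp_lfunA. Qed.

Local Notation "g \oR f" := (rcomp g f) (at level 40, left associativity).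

Lemma rcompA V W X Y (h : rhom X Y) (g : rhom W X) (f : rhom V W) :
  h \oR (g \oR f) = (h \oR g) \oR f.
Proof. by apply/rhomP=> x /=; rewrite comp_lfunA. Qed.

Lemma rcomp1l V W (f : rhom V W) : ridh W \oR f = f.
Proof. by apply/rhomP=> x /=; rewrite comp_lfun1l. Qed.

Lemma rcomp1r V W (f : rhom V W) : f \oR ridh V = f.
Proof. by apply/rhomP=> x /=; rewrite comp_lfun1r. Qed.

Lemma rcomp0l V W X (f : rhom V W) : (0 : rhom W X) \oR f = 0.
Proof. by apply/rhomP=> x /=; rewrite comp_lfun0l. Qed.

Lemma rcomp0r V W X (g : rhom W X) : g \oR (0 : rhom V W) = 0.
Proof. by apply/rhomP=> x /=; rewrite comp_lfun0r. Qed.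

Lemma rcompDl V W X (g g' : rhom W X) (f : rhom V W) :
  (g + g') \oR f = g \oR f + g' \oR f.
Proof. by apply/rhomP=> x /=; rewrite comp_lfunDl. Qed.

Lemma rcompDr V W X (g : rhom W X) (f f' : rhom V W) :
  g \oR (f + f') = g \oR f + g \oR f'.
Proof. by apply/rhomP=> x /=; rewrite comp_lfunDr. Qed.

Lemma rcompNl V W X (g : rhom W X) (f : rhom V W) : (- g) \oR f = - (g \oR f).
Proof. by apply/rhomP=> x /=; rewrite comp_lfunNl. Qed.

Lemma rcompNr V W X (g : rhom W X) (f : rhom V W) : g \oR (- f) = - (g \oR f).
Proof. by apply/rhomP=> x /=; rewrite comp_lfunNr. Qed.

Lemma rcompZl V W X c (g : rhom W X) (f : rhom V W) :
  (c *: g) \oR f = c *: (g \oR f).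
Proof. by apply/rhomP=> x /=; rewrite comp_lfunZl. Qed.

Lemma rcompZr V W X c (g : rhom W X) (f : rhom V W) :
  g \oR (c *: f) = c *: (g \oR f).
Proof. by apply/rhomP=> x /=; rewrite comp_lfunZr. Qed.

Lemma rcomp_suml V W X I (s : seq I) (g : I -> rhom W X) (f : rhom V W) :
  (\sum_(i <- s) g i) \oR f = \sum_(i <- s) (g i \oR f).
Proof.
by elim: s => [|i s IHs]; rewrite ?big_nil ?rcomp0l // !big_cons rcompDl IHs.
Qed.

Lemma rcomp_sumr V W X I (s : seq I) (g : rhom W X) (f : I -> rhom V W) :
  g \oR (\sum_(i <- s) f i) = \sum_(i <- s) (g \oR f i).
Proof.
by elim: s => [|i s IHs]; rewrite ?big_nil ?rcomp0r // !big_cons rcompDr IHs.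
Qed.

Definition rzero : rep := @Rep (fun=> 'rV[k]_0) (fun=> 0).

Definition runit : rep := @Rep (fun=> k^o) (fun=> \1%VF).

Definition rtens (V W : rep) : rep :=
  @Rep (fun x => tens (V x) (W x)) (fun a => tensf (rarr V a) (rarr W a)).

Program Definition rtensh V V' W W' (f : rhom V V') (g : rhom W W') :
    rhom (rtens V W) (rtens V' W') :=
  @RHom (rtens V W) (rtens V' W') (fun x => tensf (f x) (g x)) _.
Next Obligation. by rewrite -!tensf_comp !rfunP. Qed.

Lemma rtensh_comp V V' V'' W W' W'' (f : rhom V V') (f' : rhom V' V'')
    (g : rhom W W') (g' : rhom W' W'') :
  rtensh (f' \oR f) (g' \oR g) = rtensh f' g' \oR rtensh f g.
Proof. by apply/rhomP=> x /=; rewrite tensf_comp. Qed.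

Lemma rtens0h V V' W W' (g : rhom W W') : rtensh (0 : rhom V V') g = 0.
Proof. by apply/rhomP=> x /=; rewrite -(scale0r 0) tensfZl scale0r. Qed.

Lemma rtensh0 V V' W W' (f : rhom V V') : rtensh f (0 : rhom W W') = 0.
Proof. by apply/rhomP=> x /=; rewrite -(scale0r 0) tensfZr scale0r. Qed.

Definition rsum (V W : rep) : rep :=
  @Rep (fun x => dsum (V x) (W x))
    (fun a => (dinl _ _ \o rarr V a \o dfst _ _)
              + (dinr _ _ \o rarr W a \o dsnd _ _))%VF.

Program Definition rinl V W : rhom V (rsum V W) :=
  @RHom V (rsum V W) (fun x => dinl (V x) (W x)) _.
Next Obligation.
apply/lfunP=> v; rewrite comp_lfunE add_lfunE !comp_lfunE !dinlE dfstE dsndE /=.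
by rewrite linear0 dinrE; apply/eqP; rewrite xpair_eqE /= !addr0 !eqxx.
Qed.

Program Definition rinr V W : rhom W (rsum V W) :=
  @RHom W (rsum V W) (fun x => dinr (V x) (W x)) _.
Next Obligation.
apply/lfunP=> v; rewrite comp_lfunE add_lfunE !comp_lfunE !dinrE dfstE dsndE /=.
by rewrite linear0 dinlE; apply/eqP; rewrite xpair_eqE /= !add0r !eqxx.
Qed.

Program Definition rfst V W : rhom (rsum V W) V :=
  @RHom (rsum V W) V (fun x => dfst (V x) (W x)) _.
Next Obligation.
apply/lfunP=> v; rewrite !comp_lfunE add_lfunE !comp_lfunE dinlE dinrE !dfstE /=.
by rewrite addr0.
Qed.

Program Definition rsnd V W : rhom (rsum V W) W :=
  @RHom (rsum V W) W (fun x => dsnd (V x) (W x)) _.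
Next Obligation.
apply/lfunP=> v; rewrite !comp_lfunE add_lfunE !comp_lfunE dinlE dinrE !dsndE /=.
by rewrite add0r.
Qed.

Lemma rfst_inl V W : rfst V W \oR rinl V W = ridh V.
Proof.
by apply/rhomP=> x /=; apply/lfunP=> v; rewrite comp_lfunE dinlE dfstE id_lfunE.
Qed.

Lemma rfst_inr V W : rfst V W \oR rinr V W = 0.
Proof.
apply/rhomP=> x /=; apply/lfunP=> v.
by rewrite comp_lfunE dinrE dfstE zero_lfunE.
Qed.

Lemma rsnd_inl V W : rsnd V W \oR rinl V W = 0.
Proof.
apply/rhomP=> x /=; apply/lfunP=> v.
by rewrite comp_lfunE dinlE dsndE zero_lfunE.
Qed.

Lemma rsnd_inr V W : rsnd V W \oR rinr V W = ridh W.
Proof.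
by apply/rhomP=> x /=; apply/lfunP=> v; rewrite comp_lfunE dinrE dsndE id_lfunE.
Qed.

Lemma rsum_id V W :
  rinl V W \oR rfst V W + rinr V W \oR rsnd V W = ridh (rsum V W).
Proof.
apply/rhomP=> x /=; apply/lfunP=> -[v w].
rewrite add_lfunE !comp_lfunE dinlE dinrE dfstE dsndE id_lfunE.
by apply/eqP; rewrite xpair_eqE /= addr0 add0r !eqxx.
Qed.

Lemma rcomp_fst_inl V W X (g : rhom V X) : g \oR rfst V W \oR rinl V W = g.
Proof. by rewrite -rcompA rfst_inl rcomp1r. Qed.

Lemma rcomp_fst_inr V W X (g : rhom V X) : g \oR rfst V W \oR rinr V W = 0.
Proof. by rewrite -rcompA rfst_inr rcomp0r. Qed.

Lemma rcomp_snd_inl V W X (g : rhom W X) : g \oR rsnd V W \oR rinl V W = 0.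
Proof. by rewrite -rcompA rsnd_inl rcomp0r. Qed.

Lemma rcomp_snd_inr V W X (g : rhom W X) : g \oR rsnd V W \oR rinr V W = g.
Proof. by rewrite -rcompA rsnd_inr rcomp1r. Qed.

Definition rcomp_sumE := (rcomp_fst_inl, rcomp_fst_inr, rcomp_snd_inl,
  rcomp_snd_inr, rfst_inl, rfst_inr, rsnd_inl, rsnd_inr).

Lemma transp_nat V W (f : rhom V W) x y :
  (f y \o transp V x y = transp W x y \o f x)%VF.
Proof.
rewrite /transp; case: eqP => [e|_]; last by rewrite comp_lfun0l comp_lfun0r.
by case: y / e; rewrite comp_lfun1l comp_lfun1r.
Qed.

Lemma walk_act_nat V W (f : rhom V W) s x y :
  (f y \o walk_act V x s y = walk_act W x s y \o f x)%VF.
Proof.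
elim: s x => [|a s IHs] x /=; first exact: transp_nat.
by rewrite !comp_lfunA IHs -!(comp_lfunA (walk_act _ _ _ _)) -rfunP -!comp_lfunA transp_nat.
Qed.

Lemma act_nat V W (f : rhom V W) r x y :
  (f y \o act V r x y = act W r x y \o f x)%VF.
Proof.
apply/lfunP=> v; rewrite !comp_lfunE !sum_lfunE linear_sum.
apply: eq_bigr => p _; rewrite !scale_lfunE linearZ /=; congr (_ *: _).
by rewrite -[LHS]comp_lfunE -[RHS]comp_lfunE comp_lfunA walk_act_nat
  -!comp_lfunA transp_nat.
Qed.

Lemma satisfies_rzero R : satisfies R rzero.
Proof. by move=> r _ x y; apply/lfunP=> v; apply/rowP; case. Qed.

Lemma satisfies_rsum R V W :
  satisfies R V -> satisfies R W -> satisfies R (rsum V W).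
Proof.
move=> VR WR r Rr x y; rewrite -[act _ _ _ _]comp_lfun1r.
have /= <- := (rhomP _ _).1 (rsum_id V W) x.
rewrite comp_lfunDr !comp_lfunA -(act_nat (rinl V W)) -(act_nat (rinr V W)).
by rewrite VR // WR // !comp_lfun0r !comp_lfun0l addr0.
Qed.

Definition tensor_relations (R : set (pathalg Q k)) : Prop :=
  [/\ forall r, R r -> forall p, p \in finsupp r -> nontrivial p,
      satisfies R runit
    & forall V W, satisfies R V -> satisfies R W -> satisfies R (rtens V W)].

Section BigSum.
Variables I J : Type.
Implicit Types (F : I -> rep) (G : J -> rep).

Fixpoint rbig F (s : seq I) : rep :=
  if s is i :: s' then rsum (F i) (rbig F s') else rzero.

Lemma satisfies_rbig R F s :
  (forall i, satisfies R (F i)) -> satisfies R (rbig F s).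
Proof.
move=> FR; elim: s => [|i s IHs]; first exact: satisfies_rzero.
exact: satisfies_rsum.
Qed.

Fixpoint rbig_from F W (c : forall i, rhom (F i) W) s : rhom (rbig F s) W :=
  if s is i :: s' then
    c i \oR rfst (F i) (rbig F s') + rbig_from c s' \oR rsnd (F i) (rbig F s')
  else 0.
End BigSum.

Fixpoint rbig_to J (G : J -> rep) V (c : forall j, rhom V (G j)) t :
    rhom V (rbig G t) :=
  if t is j :: t' then
    rinl (G j) (rbig G t') \oR c j + rinr (G j) (rbig G t') \oR rbig_to c t'
  else 0.

(* The morphism of finite direct sums with matrix c. *)
Definition rbigh I J (F : I -> rep) (G : J -> rep)
    (c : forall i j, rhom (F i) (G j)) s t : rhom (rbig F s) (rbig G t) :=
  rbig_from (fun i => rbig_to (c i) t) s.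

Program Definition rtransp (I : eqType) (F : I -> rep) (i j : I) :
    rhom (F i) (F j) :=
  @RHom (F i) (F j) (fun x => transp (fun l => F l x) i j) _.
Next Obligation.
rewrite /transp; case: eqP => [e|_]; last by rewrite comp_lfun0l comp_lfun0r.
by case: j / e; rewrite comp_lfun1l comp_lfun1r.
Qed.

Lemma rtranspxx (I : eqType) (F : I -> rep) i : rtransp F i i = ridh (F i).
Proof.
apply/rhomP=> x /=; rewrite /transp; case: eqP => // e.
by rewrite eq_axiomK.
Qed.

Lemma rtransp_neq (I : eqType) (F : I -> rep) i j : i != j -> rtransp F i j = 0.
Proof.
by move=> ij; apply/rhomP=> x /=; rewrite /transp; case: eqP ij.
Qed.

Lemma rbig_from_eq0 (I : eqType) (F : I -> rep) W (c : forall i, rhom (F i) W) s :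
  (forall i, i \in s -> c i = 0) -> rbig_from c s = 0.
Proof.
elim: s => //= i s IHs c0; rewrite c0 ?mem_head // rcomp0l add0r IHs ?rcomp0l //.
by move=> j js; rewrite c0 // inE js orbT.
Qed.

Lemma rcomp_from I (F : I -> rep) W X (c : forall i, rhom (F i) W)
    (h : rhom W X) s :
  h \oR rbig_from c s = rbig_from (fun i => h \oR c i) s.
Proof. by elim: s => [|i s IHs] /=; rewrite ?rcomp0r // rcompDr !rcompA IHs. Qed.

Lemma rbig_from_to J (G : J -> rep) V W (c : forall j, rhom (G j) W)
    (b : forall j, rhom V (G j)) s :
  rbig_from c s \oR rbig_to b s = \sum_(j <- s) (c j \oR b j).
Proof.
elim: s => [|j s IHs] /=; first by rewrite big_nil rcomp0l.
rewrite big_cons -IHs rcompDl !rcompDr !rcompA -!(rcompA (c j)).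
rewrite -!(rcompA (rbig_from c s)) rfst_inl rfst_inr rsnd_inl rsnd_inr.
by rewrite !(rcomp1l, rcomp1r, rcomp0l, rcomp0r, addr0, add0r).
Qed.

Lemma rbig_to_sum J (G : J -> rep) V I (r : seq I)
    (b : I -> forall j, rhom V (G j)) s :
  \sum_(i <- r) rbig_to (b i) s = rbig_to (fun j => \sum_(i <- r) b i j) s.
Proof.
elim: s => [|j s IHs] /=; first by rewrite big1_eq.
by rewrite big_split /= -IHs !rcomp_sumr.
Qed.

Lemma rcomp_to J (G : J -> rep) V W (c : forall j, rhom W (G j)) (f : rhom V W) s :
  rbig_to c s \oR f = rbig_to (fun j => c j \oR f) s.
Proof. by elim: s => [|j s IHs] /=; rewrite ?rcomp0l // rcompDl -!rcompA IHs. Qed.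

Lemma rbig_to_eq0 J (G : J -> rep) V (c : forall j, rhom V (G j)) s :
  (forall j, c j = 0) -> rbig_to c s = 0.
Proof. by move=> c0; elim: s => //= j s ->; rewrite c0 !rcomp0r addr0. Qed.

Lemma rbigh_comp_eq0 (I J L : eqType) (F : I -> rep) (G : J -> rep) (H : L -> rep)
    (c : forall i j, rhom (F i) (G j)) (c' : forall j l, rhom (G j) (H l)) s t u :
  (forall i l, i \in s -> \sum_(j <- t) (c' j l \oR c i j) = 0) ->
  rbigh c' t u \oR rbigh c s t = 0.
Proof.
move=> cc0; rewrite /rbigh rcomp_from; apply: rbig_from_eq0 => i is_.
rewrite rbig_from_to (eq_bigr _ (fun j _ => rcomp_to _ _ _)) rbig_to_sum.
by apply: rbig_to_eq0 => l; apply: cc0.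
Qed.

End Rep.

Notation "g \oR f" := (rcomp g f) (at level 40, left associativity).

Section DerivedCategory.
Variables (Q : quiver) (k : fieldType) (R : set (pathalg Q k)).

Record cplx := Cplx {
  cob :> int -> rep Q k;
  cdiff : forall i, rhom (cob i) (cob (i + 1));
  cob_rel : forall i, satisfies R (cob i);
  cdiff2 : forall i, cdiff (i + 1) \oR cdiff i = 0;
  cbounded : exists N : nat, forall i : int, (N < `|i|)%N ->
    forall x (v : cob i x), v = 0 }.

Record cmap (X Y : cplx) := CMap {
  cfun :> forall i, rhom (X i) (Y i);
  cfunP : forall i, cdiff Y i \oR cfun i = cfun (i + 1) \oR cdiff X i }.

Lemma comp_cdiff2 (X : cplx) i V (g : rhom (X (i + 1 + 1)) V) :
  g \oR cdiff X (i + 1) \oR cdiff X i = 0.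
Proof. by rewrite -rcompA cdiff2 rcomp0r. Qed.

Program Definition cid_map X : cmap X X := @CMap X X (fun i => ridh (X i)) _.
Next Obligation. by rewrite rcomp1l rcomp1r. Qed.

Program Definition ccomp X Y Z (g : cmap Y Z) (f : cmap X Y) : cmap X Z :=
  @CMap X Z (fun i => g i \oR f i) _.
Next Obligation. by rewrite rcompA cfunP -rcompA cfunP rcompA. Qed.

(* Cohomology is indexed by degrees i + 1, that is, by all integers, so that
   the differentials into and out of the degree are cdiff i and cdiff (i + 1):
   H^{i+1}(X)_x is the quotient of cycles X i x by boundaries X i x. *)
Definition cycles (X : cplx) (i : int) (x : vert Q) : {vspace X (i + 1) x} :=
  lker (cdiff X (i + 1) x).

Definition boundaries (X : cplx) (i : int) (x : vert Q) :
    {vspace X (i + 1) x} :=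
  limg (cdiff X i x).

(* H^{i+1}(f)_x is injective and surjective for all i and x. *)
Definition qis X Y (f : cmap X Y) : Prop := forall i x,
  (forall z, z \in cycles X i x -> f (i + 1) x z \in boundaries Y i x ->
     z \in boundaries X i x) /\
  (forall y, y \in cycles Y i x ->
     exists2 z, z \in cycles X i x & y - f (i + 1) x z \in boundaries Y i x).

Definition homotopic X Y (f g : cmap X Y) : Prop :=
  exists h : forall i, rhom (X (i + 1)) (Y i), forall i,
    f (i + 1) - g (i + 1)
      = cdiff Y i \oR h i + h (i + 1) \oR cdiff X (i + 1).

Lemma cfun_cycle X Y (f : cmap X Y) i x z :
  z \in cycles X i x -> f (i + 1) x z \in cycles Y i x.
Proof.
rewrite !memv_ker -comp_lfunE => /eqP dz.
have /= -> := (rhomP _ _).1 (cfunP f (i + 1)) x.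
by rewrite comp_lfunE dz linear0.
Qed.

Lemma cfun_boundary X Y (f : cmap X Y) i x z :
  z \in boundaries X i x -> f (i + 1) x z \in boundaries Y i x.
Proof.
case/memv_imgP=> u _ ->; rewrite -comp_lfunE.
have /= <- := (rhomP _ _).1 (cfunP f i) x.
by rewrite comp_lfunE memv_img ?memvf.
Qed.

Lemma qis_id X : qis (cid_map X).
Proof.
move=> i x; split=> [z _|y cy]; first by rewrite id_lfunE.
by exists y; rewrite // id_lfunE subrr mem0v.
Qed.

Lemma qis_comp X Y Z (g : cmap Y Z) (f : cmap X Y) :
  qis f -> qis g -> qis (ccomp g f).
Proof.
move=> qf qg i x; have [fi fs] := qf i x; have [gi gs] := qg i x.
split=> [z cz|y cy].
  by rewrite comp_lfunE => bz; apply: fi => //; apply: gi => //; apply: cfun_cycle.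
have [u cu bu] := gs y cy; have [z cz bz] := fs u cu; exists z => //.
rewrite comp_lfunE -(subrK (g (i + 1) x u) y) -addrA memvD //.
by rewrite -linearB cfun_boundary.
Qed.

(* Objects of D^b((Q,R)-Rep) are the bounded complexes above; morphisms X -> Y
   are left roofs X <- Z -> Y whose left leg is a quasi-isomorphism, taken up
   to roof_eq. *)
Record roof (X Y : cplx) := Roof {
  apex : cplx;
  rleft : cmap apex X;
  rright : cmap apex Y;
  rleft_qis : qis rleft }.

Definition roof_eq X Y (r r' : roof X Y) : Prop :=
  exists (W : cplx) (t : cmap W (apex r)) (t' : cmap W (apex r')),
    [/\ qis t,
        homotopic (ccomp (rleft r) t) (ccomp (rleft r') t')
      & homotopic (ccomp (rright r) t) (ccomp (rright r') t')].

Definition roof_of X Y (f : cmap X Y) : roof X Y :=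
  @Roof X Y X (cid_map X) f (@qis_id X).

Definition roof_id X : roof X X := roof_of (cid_map X).

(* m represents the composite of g after f: complete the two inner legs to a
   square commuting up to homotopy. *)
Definition roof_comp X Y Z (g : roof Y Z) (f : roof X Y) (m : roof X Z) : Prop :=
  exists (W : cplx) (t : cmap W (apex f)) (u : cmap W (apex g)) (qt : qis t),
    homotopic (ccomp (rright f) t) (ccomp (rleft g) u) /\
    roof_eq m (Roof (ccomp (rright g) u) (qis_comp qt (rleft_qis f))).

Definition D_iso X Y (f : roof X Y) : Prop :=
  exists g : roof Y X, roof_comp g f (roof_id X) /\ roof_comp f g (roof_id Y).

Definition D_isomorphic X Y : Prop := exists f : roof X Y, D_iso f.

Program Definition czero : cplx :=
  @Cplx (fun=> rzero Q k) (fun=> 0) _ _ _.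
Next Obligation. exact: satisfies_rzero. Qed.
Next Obligation. exact: rcomp0l. Qed.
Next Obligation. by exists 0%N => i _ x v; apply/rowP; case. Qed.

Program Definition shift (X : cplx) : cplx :=
  @Cplx (fun i => X (i + 1)) (fun i => - cdiff X (i + 1)) _ _ _.
Next Obligation. exact: cob_rel. Qed.
Next Obligation. by rewrite rcompNl rcompNr opprK cdiff2. Qed.
Next Obligation.
by have [N XN] := cbounded X; exists N.+1 => i Ni; apply: XN; lia.
Qed.

Program Definition shiftf X Y (f : cmap X Y) : cmap (shift X) (shift Y) :=
  @CMap (shift X) (shift Y) (fun i => f (i + 1)) _.
Next Obligation. by rewrite rcompNl rcompNr cfunP. Qed.

Lemma qis_shift X Y (f : cmap X Y) : qis f -> qis (shiftf f).
Proof.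
move=> qf i x; have [fi fs] := qf (i + 1) x.
have lkerN (A B : vectType k) (g : 'Hom(A, B)) : lker (- g) = lker g.
  by apply/vspaceP=> v; rewrite !memv_ker opp_lfunE oppr_eq0.
have limgN (A B : vectType k) (g : 'Hom(A, B)) : limg (- g) = limg g.
  apply/vspaceP=> v; apply/memv_imgP/memv_imgP=> -[u _ ->]; exists (- u);
  by rewrite ?memvf // opp_lfunE linearN ?opprK.
split=> [z|y]; rewrite /cycles /boundaries /= !lkerN !limgN => cz; first exact: fi.
exact: fs.
Qed.

Definition roof_shift X Y (r : roof X Y) : roof (shift X) (shift Y) :=
  Roof (shiftf (rright r)) (qis_shift (rleft_qis r)).

Program Definition csum (X Y : cplx) : cplx :=
  @Cplx (fun i => rsum (X i) (Y i))
    (fun i => rinl _ _ \oR cdiff X i \oR rfst _ _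
              + rinr _ _ \oR cdiff Y i \oR rsnd _ _) _ _ _.
Next Obligation. by apply: satisfies_rsum; apply: cob_rel. Qed.
Next Obligation.
rewrite !(rcompDl, rcompDr) !rcompA.
by rewrite !rcomp_sumE !comp_cdiff2 !(rcomp0l, addr0).
Qed.
Next Obligation.
have [N XN] := cbounded X; have [M YM] := cbounded Y; exists (maxn N M) => i Ni.
by move=> x [v w]; rewrite (XN i _ x v) ?(YM i _ x w) //; lia.
Qed.

(* cone(f)^i = X^{i+1} + Y^i with d(x, y) = (- d x, f x + d y). *)
Program Definition cone X Y (f : cmap X Y) : cplx :=
  @Cplx (fun i => rsum (X (i + 1)) (Y i))
    (fun i => - (rinl _ _ \oR cdiff X (i + 1) \oR rfst _ _)
              + rinr _ _ \oR (f (i + 1) \oR rfst _ _ + cdiff Y i \oR rsnd _ _))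
    _ _ _.
Next Obligation. by apply: satisfies_rsum; apply: cob_rel. Qed.
Next Obligation.
rewrite !(rcompDl, rcompDr, rcompNl, rcompNr, opprK) !rcompA.
rewrite !rcomp_sumE !comp_cdiff2 !(rcomp0l, addr0, add0r, oppr0).
by rewrite -(rcompA _ (cdiff Y _)) cfunP rcompA addNr.
Qed.
Next Obligation.
have [N XN] := cbounded X; have [M YM] := cbounded Y.
exists (maxn N.+1 M) => i Ni.
by move=> x [v w]; rewrite (XN (i + 1) _ x v) ?(YM i _ x w) //; lia.
Qed.

Program Definition cone_in X Y (f : cmap X Y) : cmap Y (cone f) :=
  @CMap Y (cone f) (fun i => rinr _ _) _.
Next Obligation.
rewrite rcompDl rcompNl -!rcompA rfst_inr !rcomp0r oppr0 add0r rcompDl -!rcompA.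
by rewrite rfst_inr rsnd_inr rcomp1r rcomp0r add0r.
Qed.

Program Definition cone_out X Y (f : cmap X Y) : cmap (cone f) (shift X) :=
  @CMap (cone f) (shift X) (fun i => rfst _ _) _.
Next Obligation.
rewrite !(rcompDr, rcompNr) !rcompA !rcomp_sumE !(rcomp1l, rcomp0l, addr0).
by rewrite rcompNl.
Qed.

Definition D_square X Y X' Y' (f : roof X Y) (f' : roof X' Y')
    (a : roof X X') (b : roof Y Y') : Prop :=
  exists m : roof X Y', roof_comp b f m /\ roof_comp f' a m.

Definition distinguished X Y Z
    (f : roof X Y) (g : roof Y Z) (h : roof Z (shift X)) : Prop :=
  exists (X' Y' : cplx) (u : cmap X' Y')
    (a : roof X X') (b : roof Y Y') (c : roof Z (cone u)),
    [/\ D_iso a, D_iso b & D_iso c] /\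
    [/\ D_square f (roof_of u) a b,
        D_square g (roof_of (cone_in u)) b c
      & D_square h (roof_of (cone_out u)) c (roof_shift a)].

Definition window (N : nat) : seq int :=
  [seq j%:Z - N%:Z | j <- iota 0 N.*2.+1].

(* Any bound would do: enlarging it only adds zero summands to ctens. *)
Definition bound (X : cplx) : nat := sval (cid (cbounded X)).

Definition bidegrees (X Y : cplx) (n : int) : seq (int * int) :=
  [seq a <- [seq (p, q) | p <- window (bound X), q <- window (bound Y)]
     | a.1 + a.2 == n].

(* The component from X^p ⊗ Y^q to X^p' ⊗ Y^q' of d ⊗ 1 + (-1)^p 1 ⊗ d. *)
Definition tens_diff (X Y : cplx) (a b : int * int) :
    rhom (rtens (X a.1) (Y a.2)) (rtens (X b.1) (Y b.2)) :=
  rtensh (rtransp X (a.1 + 1) b.1 \oR cdiff X a.1) (rtransp Y a.2 b.2)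
  + ((-1) ^ a.1) *:
    rtensh (rtransp X a.1 b.1) (rtransp Y (a.2 + 1) b.2 \oR cdiff Y a.2).


Lemma mem_window N (i : int) : (i \in window N) = (`|i| <= N)%N.
Proof.
apply/mapP/idP => [[j]|iN]; first by rewrite mem_iota; lia.
by exists (absz (i + N%:Z)); rewrite ?mem_iota; lia.
Qed.

Lemma mem_bidegrees X Y n a : (a \in bidegrees X Y n) =
  [&& a.1 + a.2 == n, (`|a.1| <= bound X)%N & (`|a.2| <= bound Y)%N].
Proof.
rewrite mem_filter -!mem_window; case: a => p q; congr (_ && _).
by apply/allpairsP/andP => [[[? ?] [? ? [-> ->]]]|[? ?]];
  last exists (p, q).
Qed.

Lemma bidegrees_uniq X Y n : uniq (bidegrees X Y n).
Proof.
have window_uniq N : uniq (window N).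
  by rewrite map_inj_uniq ?iota_uniq // => i j; lia.
by rewrite filter_uniq // allpairs_uniq // => -[a b] [c d].
Qed.

Lemma sum_transp (X Y : cplx) n Z p q V W (f : rhom V (X p)) (g : rhom W (Y q))
    (h : forall b : int * int, rhom (rtens (X b.1) (Y b.2)) Z) :
    (p, q) \in bidegrees X Y n \/ rtensh f g = 0 ->
  \sum_(b <- bidegrees X Y n)
     h b \oR rtensh (rtransp X p b.1 \oR f) (rtransp Y q b.2 \oR g)
  = h (p, q) \oR rtensh f g.
Proof.
have h0 b : b != (p, q) ->
    h b \oR rtensh (rtransp X p b.1 \oR f) (rtransp Y q b.2 \oR g) = 0.
  case: b => p' q'; rewrite xpair_eqE rtensh_comp rcompA negb_and /=.
  case/orP; rewrite eq_sym => ne.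
    by rewrite (rtransp_neq X ne) rtens0h rcomp0r rcomp0l.
  by rewrite (rtransp_neq Y ne) rtensh0 rcomp0r rcomp0l.
case=> [pqL|fg0].
  rewrite (bigD1_seq (p, q)) ?bidegrees_uniq //= big1 ?addr0; last exact: h0.
  by rewrite !rtranspxx !rcomp1l.
rewrite fg0 rcomp0r big1 // => -[p' q'] _.
by rewrite rtensh_comp fg0 !rcomp0r.
Qed.

Lemma cob_out (X : cplx) (i : int) : (bound X < `|i|)%N -> forall V (f : rhom V (X i)), f = 0.
Proof.
move=> Xi V f; apply/rhomP=> x; apply/lfunP=> v.
by rewrite (svalP (cid (cbounded X)) i Xi x (f x v)) zero_lfunE.
Qed.

Lemma tens_diff2 X Y n a c : a \in bidegrees X Y n ->
  \sum_(b <- bidegrees X Y (n + 1)) tens_diff X Y b c \oR tens_diff X Y a b = 0.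
Proof.
case: a => p q; rewrite mem_bidegrees /= => /and3P[/eqP pqn pX qY].
under eq_bigr => b _ do rewrite rcompDr rcompZr
  -[rtransp Y q b.2]rcomp1r -[rtransp X p b.1]rcomp1r.
rewrite big_split /= -scaler_sumr !sum_transp; first last.
- rewrite mem_bidegrees /=.
  have [pN|Np] := leqP (absz (p + 1)) (bound X); [left; lia | right].
  by rewrite (cob_out Np (cdiff X p)) rtens0h.
- rewrite mem_bidegrees /=.
  have [qN|Nq] := leqP (absz (q + 1)) (bound Y); [left; lia | right].
  by rewrite (cob_out Nq (cdiff Y q)) rtensh0.
rewrite /tens_diff /= !rcompDl !rcompZl -!rtensh_comp -!rcompA !cdiff2.
rewrite !(rcomp0r, rcomp1l, rcomp1r, rtens0h, rtensh0, scaler0, addr0, add0r).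
by rewrite expfzDr ?oppr_eq0 ?oner_eq0 // expr1z mulrN1 scaleNr addNr.
Qed.

Hypothesis tensR : tensor_relations R.

Program Definition ctens (X Y : cplx) : cplx :=
  @Cplx
    (fun n => rbig (fun a => rtens (X a.1) (Y a.2)) (bidegrees X Y n))
    (fun n => rbigh (tens_diff X Y) (bidegrees X Y n) (bidegrees X Y (n + 1)))
    _ _ _.
Next Obligation.
by apply: satisfies_rbig => a; case: tensR => _ _; apply; apply: cob_rel.
Qed.
Next Obligation. by apply: rbigh_comp_eq0 => a c; apply: tens_diff2. Qed.
Next Obligation.
exists (bound X + bound Y)%N => n Nn x.
have -> : bidegrees X Y n = [::].
  case E: (bidegrees X Y n) => [//|a s]; have := mem_head a s.
  by rewrite -E mem_bidegrees; lia.
by move=> v; apply/rowP; case.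
Qed.

(* Full subcategories of D^b((Q,R)-Rep), given by their objects. *)
Definition subcat := cplx -> Prop.

Record thick_triangulated (J : subcat) : Prop := {
  thick_zero : J czero;
  thick_iso : forall X Y, D_isomorphic X Y -> J X -> J Y;
  thick_shift : forall X, J (shift X) <-> J X;
  thick_two_of_three : forall X Y Z
      (f : roof X Y) (g : roof Y Z) (h : roof Z (shift X)),
    distinguished f g h ->
    [/\ J X -> J Y -> J Z, J Y -> J Z -> J X & J X -> J Z -> J Y];
  thick_summand : forall X Y, J (csum X Y) -> J X /\ J Y }.

Definition tensor_ideal (J : subcat) : Prop :=
  thick_triangulated J /\ forall V W, J V -> J (ctens V W).

Definition prime_ideal (P : subcat) : Prop :=
  [/\ tensor_ideal P,
      exists V, ~ P V
    & forall V W, P (ctens V W) -> P V \/ P W].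

(* Subsets of Spc, and Spc itself, are predicates on subcat. *)
Definition Spc : subcat -> Prop := prime_ideal.

Definition Zset (S : cplx -> Prop) : subcat -> Prop :=
  fun P => Spc P /\ forall V, S V -> ~ P V.

Definition Spc_closed (A : subcat -> Prop) : Prop :=
  exists S : cplx -> Prop, forall P, A P <-> Zset S P.

Definition Spc_open (A : subcat -> Prop) : Prop :=
  (forall P, A P -> Spc P) /\ Spc_closed (fun P => Spc P /\ ~ A P).

Definition Spc_discrete : Prop :=
  forall A : subcat -> Prop, (forall P, A P -> Spc P) -> Spc_open A.

(* H(V)_n = 0: in every degree, all cycles at n are boundaries. *)
Definition vertex_ideal (n : vert Q) : subcat :=
  fun V => forall i, (cycles V i n <= boundaries V i n)%VS.

End DerivedCategory.

(* Main.v *)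
(** Let S_n be the simple representation at the vertex n.  If a prime P
   contained every S_n it would contain the unit, which is filtered by the S_n
   because Q has no oriented cycles, and P would not be proper; so S_n is not
   in P for some n.  If H(V)_n = 0 then V ⊗ S_n is acyclic, hence in P, and V is
   in P by primality.  If H(V)_n <> 0 then S_n is a direct summand of V ⊗ S_n[p]
   for some p, so V is not in P.  Hence P = P_n.  Conversely P_n is a prime
   ideal by the Künneth formula over k.  The space is discrete because the
   semisimple representation supported at a set B of vertices lies outside P_n
   exactly for n in B. *)

Require Import Defs.
From mathcomp Require Import all_boot all_algebra.
From mathcomp Require Import boolp classical_sets.

Set Implicit Arguments.
Unset Strict Implicit.
Unset Printing Implicit Defensive.

Import GRing.Theory.

Local Open Scope ring_scope.

(** * Cohomology at a vertex and distinguished triangles *)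

(** Membership in an ideal is always obtained from honest chain maps: quasi-isomorphisms give
    isomorphic objects and cones give triangles. Arbitrary roofs are analysed only to show that
    isomorphisms preserve [vertex_ideal]. Thickness speaks of [csum] alone, hence retracts have to
    be completed to direct sums. Tensor ideals absorb a factor on the right, so the member of the
    ideal stands on the left: V is a retract of U ⊗ V for the unit U, and S_n is a retract of V ⊗
    S_n[p]. The latter splits because all arrows of V ⊗ S_n act as zero, so it is a complex of
    vector spaces at n. Relations hold on S_n because they involve only non-trivial paths, and on
    the layers of the unit because these are subrepresentations of it. Equations such as i + 1 - 1 =
    i between degrees do not hold by computation; [rtransp], a Kronecker delta, absorbs them. *)

Section VertexIdeal.
Variables (Q : quiver) (k : fieldType) (R : set (pathalg Q k)).
Local Notation cplx := (cplx R).
Implicit Types (X Y Z : cplx) (i : int).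

Lemma cdiff2E X i x v : cdiff X (i + 1) x (cdiff X i x v) = 0.
Proof.
rewrite -comp_lfunE; have /= -> := (rhomP _ _).1 (cdiff2 X i) x.
by rewrite zero_lfunE.
Qed.

Lemma cfunPE X Y (f : cmap X Y) i x v :
  cdiff Y i x (f i x v) = f (i + 1) x (cdiff X i x v).
Proof.
by rewrite -!comp_lfunE; have /= -> := (rhomP _ _).1 (cfunP f i) x.
Qed.

Lemma cone_diffE X Y (f : cmap X Y) i x (u : cone f i x) :
  cdiff (cone f) i x u
  = (- cdiff X (i + 1) x u.1, f (i + 1) x u.1 + cdiff Y i x u.2).
Proof.
rewrite /= add_lfunE opp_lfunE !comp_lfunE add_lfunE !comp_lfunE.
rewrite !dfstE !dsndE dinlE dinrE.
by apply/eqP; rewrite xpair_eqE /= oppr0 addr0 add0r !eqxx.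
Qed.

Lemma csum_diffE X Y i x (u : csum X Y i x) :
  cdiff (csum X Y) i x u = (cdiff X i x u.1, cdiff Y i x u.2).
Proof.
rewrite /= add_lfunE !comp_lfunE !dfstE !dsndE dinlE dinrE.
by apply/eqP; rewrite xpair_eqE /= addr0 add0r !eqxx.
Qed.

Lemma cyclesP X i x v : reflect (cdiff X (i + 1) x v = 0) (v \in cycles X i x).
Proof. by rewrite memv_ker; apply: eqP. Qed.

Lemma boundariesP X i x v :
  reflect (exists u, v = cdiff X i x u) (v \in boundaries X i x).
Proof.
apply: (iffP memv_imgP) => [[u _ ->]|[u ->]]; first by exists u.
by exists u; rewrite ?memvf.
Qed.

Lemma vertex_idealP X n :
  vertex_ideal n X <->
  forall (i : int) v, cdiff X (i + 1) n v = 0 -> exists u, v = cdiff X i n u.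
Proof.
split=> [Xn i v dv|Xn i].
  by apply/boundariesP/(subvP (Xn i)); apply/cyclesP.
by apply/subvP=> v /cyclesP/Xn/boundariesP.
Qed.

Lemma homotopic_ext X Y (f g : cmap X Y) :
  (forall i, f i = g i) -> homotopic f g.
Proof.
by move=> fg; exists (fun=> 0) => i; rewrite fg subrr rcomp0r rcomp0l addr0.
Qed.

Lemma homotopic_boundary X Y (f g : cmap X Y) i x z :
  homotopic f g -> z \in cycles X i x ->
  f (i + 1) x z - g (i + 1) x z \in boundaries Y i x.
Proof.
case=> h fgh /cyclesP dz; apply/boundariesP; exists (h i x z).
have /= /lfunP/(_ z) := (rhomP _ _).1 (fgh i) x.
by rewrite !add_lfunE opp_lfunE !comp_lfunE dz linear0 addr0.
Qed.

Lemma D_isomorphic_sym X Y : D_isomorphic X Y -> D_isomorphic Y X.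
Proof. by case=> f [g [gf fg]]; exists g, f. Qed.

(** The inverse is the roof with the same apex and the legs exchanged. *)
Lemma qis_D_iso X Y (f : cmap X Y) : qis f -> D_iso (roof_of f).
Proof.
move=> qf; exists (@Roof _ _ _ Y X X f (cid_map X) qf); split.
  exists X, (cid_map X), (cid_map X), (@qis_id _ _ _ X); split.
    exact: homotopic_ext.
  exists X, (cid_map X), (cid_map X); split; first exact: qis_id.
    by apply: homotopic_ext => i /=; rewrite !rcomp1r.
  by apply: homotopic_ext => i /=; rewrite !rcomp1r.
exists X, (cid_map X), (cid_map X), (@qis_id _ _ _ X); split.
  exact: homotopic_ext.
exists X, f, (cid_map X); split => //.
  by apply: homotopic_ext => i /=; rewrite !rcomp1r rcomp1l.
by apply: homotopic_ext => i /=; rewrite !rcomp1r rcomp1l.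
Qed.

Lemma qis_isomorphic X Y (f : cmap X Y) : qis f -> D_isomorphic X Y.
Proof. by move=> qf; exists (roof_of f); apply: qis_D_iso. Qed.

Lemma cone_distinguished X Y (f : cmap X Y) :
  distinguished (roof_of f) (roof_of (cone_in f)) (roof_of (cone_out f)).
Proof.
have comp1l (A B : cplx) (g : cmap A B) :
    roof_comp (roof_id B) (roof_of g) (roof_of g).
  exists A, (cid_map A), g, (@qis_id _ _ _ A); split.
    by apply: homotopic_ext => i /=; rewrite rcomp1l rcomp1r.
  exists A, (cid_map A), (cid_map A); split; first exact: qis_id.
    by apply: homotopic_ext => i /=; rewrite !rcomp1r.
  by apply: homotopic_ext => i /=; rewrite !(rcomp1r, rcomp1l).
have comp1r (A B : cplx) (g : cmap A B) :
    roof_comp (roof_of g) (roof_id A) (roof_of g).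
  exists A, (cid_map A), (cid_map A), (@qis_id _ _ _ A); split.
    exact: homotopic_ext.
  exists A, (cid_map A), (cid_map A); split; first exact: qis_id.
    by apply: homotopic_ext => i /=; rewrite !rcomp1r.
  by apply: homotopic_ext => i /=; rewrite !(rcomp1r, rcomp1l).
exists X, Y, f, (roof_id X), (roof_id Y), (roof_id (cone f)); split.
  by split; apply: qis_D_iso; apply: qis_id.
split.
- by exists (roof_of f).
- by exists (roof_of (cone_in f)).
(* The shift of an identity roof is not literally an identity roof, so the composite with it is
   refined by hand. *)
exists (roof_of (cone_out f)); split=> //.
exists (cone f), (cid_map _), (cone_out f), (@qis_id _ _ _ _); split.
  by apply: homotopic_ext => i /=; rewrite rcomp1l rcomp1r.
exists (cone f), (cid_map _), (cid_map _); split; first exact: qis_id.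
  by apply: homotopic_ext => i /=; rewrite !rcomp1r.
by apply: homotopic_ext => i /=; rewrite !(rcomp1r, rcomp1l).
Qed.

(** Since [f] after [g] is the identity, every class of [Y] at [n] factors, up to a boundary,
    through the apex of [f], whose cohomology is that of [X]. *)
Lemma vertex_ideal_iso n X Y :
  D_isomorphic X Y -> vertex_ideal n X -> vertex_ideal n Y.
Proof.
case=> f [g [_ [W [t [u [qt [_ [W' [s [s' [qs /= _ sf]]]]]]]]]]] Xn i.
apply/subvP=> y cy; have [w cw yw] := (qs i n).2 y cy.
have := homotopic_boundary sf cw; rewrite /= !comp_lfunE id_lfunE => swb.
suff fwb :
    rright f (i + 1) n (u (i + 1) n (s' (i + 1) n w)) \in boundaries Y i n.
  by have := memvD yw (memvD swb fwb); rewrite !subrK.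
have ca : u (i + 1) n (s' (i + 1) n w) \in cycles (apex f) i n.
  by do 2![apply: cfun_cycle].
apply/cfun_boundary/((rleft_qis f) i n).1 => //.
by apply: (subvP (Xn i)); apply: cfun_cycle.
Qed.

(* Cohomology is indexed by degrees i + 1; this recovers all degrees. *)
Lemma int_surj_succ (P : int -> Prop) : (forall i, P (i + 1)) -> forall i, P i.
Proof. by move=> PS i; rewrite -(subrK 1 i). Qed.

(** This is the long exact sequence of a cone, chased on elements. In the second case a cocycle a of
    [X] lifts to the cocycle (a, -b) of the cone, where f a = d b. *)
Lemma vertex_ideal_cone n X Y (f : cmap X Y) :
  [/\ vertex_ideal n X -> vertex_ideal n Y -> vertex_ideal n (cone f),
      vertex_ideal n Y -> vertex_ideal n (cone f) -> vertex_ideal n X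
    & vertex_ideal n X -> vertex_ideal n (cone f) -> vertex_ideal n Y].
Proof.
split=> /vertex_idealP H1 /vertex_idealP H2; apply/vertex_idealP.
- move=> i [a b]; rewrite cone_diffE /= => -[da dab].
  move/eqP: da; rewrite oppr_eq0 => /eqP/(H1 (i + 1))[a' a'E].
  have [b' b'E] : exists b', b + f (i + 1) n a' = cdiff Y i n b'.
    by apply: (H2 i); rewrite linearD /= cfunPE -a'E [LHS]addrC.
  exists (- a', b'); rewrite cone_diffE /= -b'E linearN /= -a'E.
  by rewrite opprK linearN addrCA addNr addr0.
- apply: int_surj_succ => i a da.
  have [b bE] : exists b, f (i + 1 + 1) n a = cdiff Y (i + 1) n b.
    by apply: (H1 (i + 1)); rewrite cfunPE da linear0.
  have [] := H2 i (a, - b).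
    by rewrite cone_diffE /= linearN /= -bE subrr da oppr0.
  move=> [c e]; rewrite cone_diffE /= => -[ac _].
  by exists (- c); rewrite linearN.
- move=> i b db; have [] := H2 i (0, b).
    by rewrite cone_diffE /= db !linear0 addr0.
  move=> [c e]; rewrite cone_diffE /= => -[ac bE].
  have [|c' c'E] := H1 i c; first by apply: oppr_inj; rewrite oppr0.
  by exists (f i n c' + e); rewrite bE linearD /= cfunPE -c'E.
Qed.

Lemma vertex_ideal_shift n X : vertex_ideal n (shift X) <-> vertex_ideal n X.
Proof.
have dE i (u : shift X i n) : cdiff (shift X) i n u = - cdiff X (i + 1) n u.
  by rewrite /= opp_lfunE.
split=> /vertex_idealP Xn; apply/vertex_idealP.
  apply: int_surj_succ => i v dv.
  have [|u ->] := Xn i v; first by rewrite dE dv oppr0.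
  by exists (- u); rewrite dE linearN.
move=> i v; rewrite dE => /eqP; rewrite oppr_eq0 => /eqP/(Xn (i + 1))[u ->].
by exists (- u); rewrite dE linearN opprK.
Qed.

Lemma vertex_ideal_summand n X Y :
  vertex_ideal n (csum X Y) -> vertex_ideal n X /\ vertex_ideal n Y.
Proof.
move=> /vertex_idealP H; split; apply/vertex_idealP => i v dv.
  have [|[a b]] := H i (v, 0); first by rewrite csum_diffE /= linear0 dv.
  by rewrite csum_diffE => -[-> _]; exists a.
have [|[a b]] := H i (0, v); first by rewrite csum_diffE /= linear0 dv.
by rewrite csum_diffE => -[_ ->]; exists b.
Qed.

Lemma vertex_ideal_zero n : vertex_ideal n (czero R).
Proof.
by apply/vertex_idealP => i v _; exists 0; rewrite linear0; apply/rowP; case.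
Qed.

Lemma vertex_ideal_thick n : thick_triangulated (@vertex_ideal Q k R n).
Proof.
split.
- exact: vertex_ideal_zero.
- exact: vertex_ideal_iso.
- exact: vertex_ideal_shift.
- move=> X Y Z f g h [X' [Y' [u [a [b [c [[Da Db Dc] _]]]]]]].
  have iso (A B : cplx) (r : roof A B) :
      D_iso r -> vertex_ideal n A = vertex_ideal n B.
    move=> Dr; have AB : D_isomorphic A B by exists r.
    apply/propext; split; apply: vertex_ideal_iso => //.
    exact: D_isomorphic_sym.
  rewrite (iso _ _ _ Da) (iso _ _ _ Db) (iso _ _ _ Dc).
  exact: vertex_ideal_cone.
- exact: vertex_ideal_summand.
Qed.

End VertexIdeal.

(** * Short exact sequences, retracts and acyclic complexes in thick subcategories *)

Section Thick.
Variables (Q : quiver) (k : fieldType) (R : set (pathalg Q k)).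
Local Notation cplx := (cplx R).
Implicit Types (X Y Z : cplx) (i : int).

Definition ses X Y Z (f : cmap X Y) (g : cmap Y Z) : Prop :=
  forall i x,
  [/\ forall v, f i x v = 0 -> v = 0,
      forall v, g i x (f i x v) = 0,
      forall y, g i x y = 0 -> exists v, y = f i x v
    & forall z, exists y, z = g i x y].

(** The comparison map (a, b) |-> g b is a quasi-isomorphism; this turns short exact sequences of
    complexes into triangles. *)
Lemma ses_cone X Y Z (f : cmap X Y) (g : cmap Y Z) :
  ses f g -> D_isomorphic (cone f) Z.
Proof.
move=> fg.
have gf0 i : g i \oR f i = 0.
  apply/rhomP=> x; apply/lfunP=> v; rewrite /= comp_lfunE zero_lfunE.
  by case: (fg i x).
have hP i : cdiff Z i \oR (g i \oR rsnd (X (i + 1)) (Y i))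
    = g (i + 1) \oR rsnd (X (i + 1 + 1)) (Y (i + 1)) \oR cdiff (cone f) i.
  apply/rhomP=> x; apply/lfunP=> -[a b].
  rewrite -rcompA [RHS]comp_lfunE [in RHS]comp_lfunE cone_diffE.
  rewrite [LHS]comp_lfunE [in LHS]comp_lfunE !dsndE /= linearD /=.
  by case: (fg (i + 1) x) => _ -> _ _; rewrite add0r cfunPE.
pose h := @CMap _ _ _ (cone f) Z _ hP.
have hE i x u : h i x u = g i x u.2 by rewrite /= comp_lfunE dsndE.
apply: (qis_isomorphic (f := h)) => i x; split.
  move=> [a b] /cyclesP; rewrite cone_diffE hE => -[da dab].
  case/boundariesP=> z gbz; apply/boundariesP.
  have [_ _ _ /(_ z)[b' zE]] := fg i x.
  have [_ _ ex _] := fg (i + 1) x.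
  have [|a' a'E] := ex (b - cdiff Y i x b').
    by rewrite linearB /= gbz zE cfunPE subrr.
  exists (a', b'); rewrite cone_diffE /= -a'E addrNK; congr pair.
  have [inj _ _ _] := fg (i + 1 + 1) x; apply/eqP.
  rewrite -addr_eq0; apply/eqP/inj; rewrite linearD /= -cfunPE -a'E linearB /=.
  by rewrite cdiff2E subr0.
move=> z /cyclesP dz; have [_ _ _ /(_ z)[y zE]] := fg (i + 1) x.
have [_ _ ex _] := fg (i + 1 + 1) x.
have [|a aE] := ex (cdiff Y (i + 1) x y); first by rewrite -cfunPE -zE.
exists (- a, y); last by rewrite hE /= zE subrr mem0v.
apply/cyclesP; rewrite cone_diffE /= !linearN /= aE addNr opprK; congr pair.
have [inj _ _ _] := fg (i + 1 + 1 + 1) x; apply: inj.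
by rewrite -cfunPE -aE cdiff2E.
Qed.

(* The retraction g and the map to the cone of f together split X. *)
Lemma retract_csum A X (f : cmap A X) (g : cmap X A) :
  (forall i, g i \oR f i = ridh (A i)) -> D_isomorphic X (csum A (cone f)).
Proof.
move=> gf.
have gfE i x v : g i x (f i x v) = v.
  rewrite -comp_lfunE; have /= -> := (rhomP _ _).1 (gf i) x.
  exact: id_lfunE.
pose hf i : rhom (X i) (csum A (cone f) i) :=
  rinl _ _ \oR g i + rinr _ _ \oR cone_in f i.
have hfE i x v : hf i x v = (g i x v, (0, v)).
  rewrite /= add_lfunE !comp_lfunE dinlE !dinrE.
  by apply/eqP; rewrite xpair_eqE /= addr0 add0r !eqxx.
have hP i : cdiff (csum A (cone f)) i \oR hf i = hf (i + 1) \oR cdiff X i.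
  apply/rhomP=> x; apply/lfunP=> v.
  rewrite [LHS]comp_lfunE [RHS]comp_lfunE hfE csum_diffE hfE cone_diffE /=.
  by rewrite cfunPE !linear0 add0r.
pose h := @CMap _ _ _ X (csum A (cone f)) _ hP.
apply: (qis_isomorphic (f := h)) => i x; split.
  move=> v /cyclesP dv /boundariesP[[a [b c]]].
  rewrite hfE csum_diffE cone_diffE /=.
  case=> gva /esym/eqP; rewrite oppr_eq0 => /eqP db vE; apply/boundariesP.
  have bE : b = cdiff A i x (a - g i x c).
    by apply/eqP; rewrite linearB /= -gva vE linearD /= cfunPE gfE addrK.
  by exists (f i x (a - g i x c) + c); rewrite linearD /= cfunPE -bE.
move=> [a [a' x']] /cyclesP; rewrite csum_diffE cone_diffE /= => -[da /eqP].
rewrite oppr_eq0 => /eqP da' dx'.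
have a'E : a' = - cdiff A (i + 1) x (g (i + 1) x x').
  by apply/eqP; rewrite -addr_eq0 cfunPE -{1}[a']gfE -linearD /= dx' linear0.
(* Replacing the [g]-part of [x'] by [a] makes the first coordinate of [h] equal to [a]; the error
   then lies in the image of [f], and the cone makes it a boundary. *)
exists (x' - f (i + 1) x (g (i + 1) x x') + f (i + 1) x a).
  apply/cyclesP; rewrite linearD linearB /= !cfunPE da linear0 addr0.
  by move/eqP: dx'; rewrite a'E linearN /= cfunPE [X in X == _]addrC => /eqP.
apply/(boundariesP (X := csum A (cone f)) (i := i) (x := x)).
exists (0, (g (i + 1) x x' - a, 0)).
rewrite csum_diffE cone_diffE hfE.
apply/eqP; rewrite !xpair_eqE; apply/and3P; split; apply/eqP => /=.
- by rewrite linear0 linearD linearB /= !gfE subrr add0r subrr.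
- by rewrite subr0 linearB /= da subr0.
by rewrite linear0 addr0 linearB /= opprD opprB addrA [X in X - _]addrC subrK.
Qed.


Section ThickIdeal.
Variable J : subcat R.
Hypothesis tJ : thick_triangulated J.

Lemma thick_cone X Y (f : cmap X Y) :
  [/\ J X -> J Y -> J (cone f), J Y -> J (cone f) -> J X
    & J X -> J (cone f) -> J Y].
Proof. by have [_ _ _ H _] := tJ; apply: H (cone_distinguished f). Qed.

Lemma thick_ses X Y Z (f : cmap X Y) (g : cmap Y Z) :
  ses f g -> J X -> J Z -> J Y.
Proof.
move=> fg JX JZ; have [_ _] := thick_cone f; apply=> //.
by apply: (thick_iso tJ) JZ; apply/D_isomorphic_sym/ses_cone/fg.
Qed.

Lemma thick_retract A X (f : cmap A X) (g : cmap X A) :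
  (forall i, g i \oR f i = ridh (A i)) -> J X -> J A.
Proof.
by move=> gf /(thick_iso tJ (retract_csum gf))/(thick_summand tJ)[].
Qed.

Lemma thick_acyclic X : (forall n, vertex_ideal n X) -> J X.
Proof.
move=> X0; pose f := @CMap _ _ _ X (czero R) (fun=> 0)
  (fun i => etrans (rcomp0r _ _) (esym (rcomp0l _ _))).
have qf : qis f.
  move=> i x; split=> [z /(subvP (X0 x i))//|y _]; exists 0; first exact: mem0v.
  by have -> : y - f (i + 1) x 0 = 0; [apply/rowP; case | exact: mem0v].
apply: (thick_iso tJ) (thick_zero tJ).
exact/D_isomorphic_sym/qis_isomorphic/qf.
Qed.

End ThickIdeal.

End Thick.

(** * The bigraded components of a tensor product of complexes *)

Section Rep.
Variables (Q : quiver) (k : fieldType).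
Implicit Types V W : rep Q k.

Lemma rzero_eq x (u v : rzero Q k x) : u = v.
Proof. by apply/rowP; case. Qed.

Lemma rtensh_id V W : rtensh (ridh V) (ridh W) = ridh (rtens V W).
Proof.
apply/rhomP=> x; apply/lfunP=> t; apply/lfunP=> phi.
by rewrite /= tensfE !comp_lfunE !id_lfunE dualfE comp_lfun1r.
Qed.

Lemma rbig_from_eq (I : eqType) (F : I -> rep Q k) W
    (c c' : forall i, rhom (F i) W) s :
  {in s, forall i, c i = c' i} -> rbig_from c s = rbig_from c' s.
Proof.
elim: s => //= i s IHs cc'; rewrite cc' ?mem_head // IHs // => j js.
by rewrite cc' // inE js orbT.
Qed.

Lemma rbig_to_eq (I : eqType) (F : I -> rep Q k) W
    (c c' : forall i, rhom W (F i)) s :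
  {in s, forall i, c i = c' i} -> rbig_to c s = rbig_to c' s.
Proof.
elim: s => //= i s IHs cc'; rewrite cc' ?mem_head // IHs // => j js.
by rewrite cc' // inE js orbT.
Qed.

Lemma rbig_toD (I : eqType) (F : I -> rep Q k) W
    (c c' : forall i, rhom W (F i)) s :
  rbig_to c s + rbig_to c' s = rbig_to (fun i => c i + c' i) s.
Proof.
elim: s => [|i s IHs] /=; first by rewrite addr0.
by rewrite -IHs !rcompDr addrACA.
Qed.

Lemma rbig_toZ (I : eqType) (F : I -> rep Q k) W a
    (c : forall i, rhom W (F i)) s :
  a *: rbig_to c s = rbig_to (fun i => a *: c i) s.
Proof.
elim: s => [|i s IHs] /=; first by rewrite scaler0.
by rewrite -IHs !rcompZr scalerDr.
Qed.

(** The Kronecker delta is the identity matrix; a repeated index would put identities off the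
    diagonal, hence [uniq]. *)
Lemma rbigh_transp (I : eqType) (F : I -> rep Q k) s :
  uniq s -> rbigh (rtransp F) s s = ridh (rbig F s).
Proof.
rewrite /rbigh; elim: s => /= [_|i s IHs /andP[i_s /IHs{}IHs]].
  by apply/rhomP=> x; apply/lfunP=> v; apply/rowP; case.
rewrite rtranspxx rcomp1r.
rewrite (@rbig_to_eq _ _ _ (rtransp F i) (fun=> 0)); last first.
  by move=> j js; apply: rtransp_neq; apply: contraNneq i_s => ->.
rewrite rbig_to_eq0 // rcomp0r addr0.
rewrite (@rbig_from_eq _ _ _ _
  (fun j => rinr (F i) (rbig F s) \oR rbig_to (rtransp F j) s)).
  by rewrite -rcomp_from IHs rcomp1r rsum_id.
move=> j js; rewrite rtransp_neq ?rcomp0r ?add0r //.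
by apply: contraNneq i_s => <-.
Qed.

End Rep.

Section TensorComponents.
Variables (Q : quiver) (k : fieldType) (R : set (pathalg Q k)).
Local Notation cplx := (cplx R).
Implicit Types (X Y Z : cplx) (i : int).

Hypothesis hR : tensor_relations R.
Variables X Y : cplx.
Implicit Types p q n : int.

(* The inclusion of, and projection to, the summand X^p ⊗ Y^q in degree n; both
   are 0 unless p + q = n. *)
Definition tin p q n : rhom (rtens (X p) (Y q)) (ctens hR X Y n) :=
  rbig_to (fun b => rtensh (rtransp X p b.1) (rtransp Y q b.2))
    (bidegrees X Y n).

Definition tout p q n : rhom (ctens hR X Y n) (rtens (X p) (Y q)) :=
  rbig_from (fun a => rtensh (rtransp X a.1 p) (rtransp Y a.2 q))
    (bidegrees X Y n).

(** Outside the list of bidegrees one of the two factors is the zero representation, so identities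
    below have to be checked on listed bidegrees only. *)
Lemma rtens_out p q n V (f g : rhom (rtens (X p) (Y q)) V) :
  p + q = n -> (p, q) \notin bidegrees X Y n -> f = g.
Proof.
rewrite mem_bidegrees /= => ->; rewrite eqxx /= negb_and -!ltnNge => out.
rewrite -(rcomp1r f) -(rcomp1r g) -rtensh_id; case/orP: out => out.
  by rewrite (cob_out out (ridh _)) rtens0h !rcomp0r.
by rewrite (cob_out out (ridh _)) rtensh0 !rcomp0r.
Qed.

Lemma tout_tin p q p' q' n : p' + q' = n ->
  tout p q n \oR tin p' q' n = rtensh (rtransp X p' p) (rtransp Y q' q).
Proof.
move=> pqn; have [pqb|pqb] := boolP ((p', q') \in bidegrees X Y n); last first.
  exact: rtens_out pqb.
rewrite /tout /tin rbig_from_to.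
(* The inserted identities give the summands the shape required by [sum_transp], which collapses the
   sum to the index (p', q'). *)
under eq_bigr => b _ do rewrite -[rtransp Y q' b.2]rcomp1r
  -[rtransp X p' b.1]rcomp1r.
rewrite (@sum_transp _ _ _ _ _ _ _ _ _ _ _ _ _
  (fun b => rtensh (rtransp X b.1 p) (rtransp Y b.2 q))); last by left.
by rewrite rtensh_id rcomp1r.
Qed.

Lemma tin_ext n V (f g : rhom (ctens hR X Y n) V) :
  (forall p q, p + q = n -> f \oR tin p q n = g \oR tin p q n) -> f = g.
Proof.
move=> fg; rewrite -(rcomp1r f) -(rcomp1r g) -rbigh_transp ?bidegrees_uniq //.
rewrite /rbigh !rcomp_from; apply: rbig_from_eq => -[p q].
rewrite mem_bidegrees => /andP[/eqP/fg pqn _].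
suff tE : rbig_to (rtransp (fun a : int * int => rtens (X a.1) (Y a.2)) (p, q))
    (bidegrees X Y n) = tin p q n by rewrite tE pqn.
apply: rbig_to_eq => -[p' q'] _ /=; have [[<- <-]|] := eqVneq (p, q) (p', q').
  by rewrite !rtranspxx rtensh_id.
move=> ne; rewrite (rtransp_neq _ ne); move: ne; rewrite xpair_eqE negb_and.
by case/orP=> /rtransp_neq-> ; rewrite ?rtens0h ?rtensh0.
Qed.

(** The Leibniz rule on one summand. At the edge of the window it persists because [tin] of an
    unlisted bidegree is zero. *)
Lemma tin_diff p q n : p + q = n ->
  cdiff (ctens hR X Y) n \oR tin p q n
  = tin (p + 1) q (n + 1) \oR rtensh (cdiff X p) (ridh (Y q))
    + (-1) ^ p *: (tin p (q + 1) (n + 1) \oR rtensh (ridh (X p)) (cdiff Y q)).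
Proof.
move=> pqn; have [pqb|pqb] := boolP ((p, q) \in bidegrees X Y n); last first.
  exact: rtens_out pqb.
rewrite /tin /= /rbigh rbig_from_to.
under eq_bigr => b _ do rewrite -[rtransp Y q b.2]rcomp1r
  -[rtransp X p b.1]rcomp1r.
rewrite (@sum_transp _ _ _ _ _ _ _ _ _ _ _ _ _
  (fun b => rbig_to (tens_diff X Y b) (bidegrees X Y (n + 1)))); last by left.
rewrite rtensh_id rcomp1r !rcomp_to rbig_toZ rbig_toD; apply: rbig_to_eq => b _.
by rewrite -!rtensh_comp !rcomp1r.
Qed.

Lemma tin_tout_id n :
  \sum_(b <- bidegrees X Y n) tin b.1 b.2 n \oR tout b.1 b.2 n
  = ridh (ctens hR X Y n).
Proof.
apply: tin_ext => p q pqn; rewrite rcomp_suml rcomp1l.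
have [pqb|pqb] := boolP ((p, q) \in bidegrees X Y n); last exact: rtens_out pqb.
under eq_bigr => b _ do rewrite -rcompA tout_tin // -[rtransp Y q b.2]rcomp1r
  -[rtransp X p b.1]rcomp1r.
rewrite (@sum_transp _ _ _ _ _ _ _ _ _ _ _ _ _ (fun b => tin b.1 b.2 n)).
  by rewrite rtensh_id rcomp1r.
by left.
Qed.

Lemma rsumE (V W : rep Q k) I (r : seq I) (f : I -> rhom V W) (x : vert Q) :
  (\sum_(i <- r) f i) x = \sum_(i <- r) f i x.
Proof. by elim/big_rec2: _ => //= i y z _ <-. Qed.

(** Contractions and functionals are chosen vertex by vertex and need not commute with the arrows,
    so extensionality is stated for linear maps at [x]. *)
Lemma tin_ext_at n x (V : vectType k) (f g : 'Hom(ctens hR X Y n x, V)) :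
  (forall p q, p + q = n -> f \o tin p q n x = g \o tin p q n x)%VF -> f = g.
Proof.
move=> fg; rewrite -(comp_lfun1r f) -(comp_lfun1r g).
have /= <- := (rhomP _ _).1 (tin_tout_id n) x.
apply/lfunP=> v; rewrite rsumE !comp_lfunE !sum_lfunE !linear_sum.
rewrite big_seq [RHS]big_seq; apply: eq_bigr => -[p q].
rewrite mem_bidegrees /= => /andP[/eqP/fg pq _].
by rewrite -!comp_lfunE !comp_lfunA pq.
Qed.

End TensorComponents.

(** * The Künneth formula at a vertex *)

Section Evaluation.
Variable k : fieldType.
Implicit Types V W : vectType k.

(** This is phi ⊗ 1 followed by k ⊗ W = W, since V ⊗ W is encoded as Hom(V^*, W). *)
Definition tens_ev V W (phi : dual V) : 'Hom(tens V W, W) :=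
  linfun (fun t : 'Hom(dual V, W) => t phi).

Lemma tens_evE V W (phi : dual V) (t : tens V W) :
  tens_ev W phi t = (t : 'Hom(_, _)) phi.
Proof.
apply: (linfunE (V := tens V W)) => c a b.
by rewrite add_lfunE scale_lfunE.
Qed.

Lemma tens_ev_ptens V W (phi : dual V) (v : V) (w : W) :
  tens_ev W phi (ptens v w) = (phi v : k) *: w.
Proof. by rewrite tens_evE ptensE. Qed.

Lemma tens_ev_tensf V V' W W' (phi : dual V') (f : 'Hom(V, V'))
    (g : 'Hom(W, W')) :
  (tens_ev W' phi \o tensf f g = g \o tens_ev W (phi \o f)%VF)%VF.
Proof.
apply/lfunP=> t; rewrite !comp_lfunE !tens_evE tensfE.
by rewrite !comp_lfunE dualfE.
Qed.

Lemma tens_ev0 V W : tens_ev W (0 : dual V) = 0.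
Proof. by apply/lfunP=> t; rewrite tens_evE linear0 zero_lfunE. Qed.

Lemma ptens0l V W (w : W) : ptens (0 : V) w = 0.
Proof.
by apply/lfunP=> phi; rewrite ptensE linear0 scale0r zero_lfunE.
Qed.

Lemma ptens0r V W (v : V) : ptens v (0 : W) = 0.
Proof. by apply/lfunP=> phi; rewrite ptensE scaler0 zero_lfunE. Qed.

Lemma ptens_linearr V W (v : V) : linear (ptens (W := W) v).
Proof.
move=> c a b; apply/lfunP=> phi; rewrite add_lfunE scale_lfunE !ptensE.
by rewrite scalerDr !scalerA mulrC.
Qed.

Definition ptensr V W (v : V) : 'Hom(W, tens V W) := linfun (ptens v).

Lemma ptensrE V W (v : V) (w : W) : ptensr W v w = ptens v w.
Proof. exact/linfunE/ptens_linearr. Qed.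

Lemma tensf_id V W : tensf \1%VF \1%VF = \1%VF :> 'Hom(tens V W, tens V W).
Proof.
by apply/lfunP=> t; rewrite tensfE id_lfunE; apply/lfunP=> phi;
  rewrite !comp_lfunE id_lfunE dualfE comp_lfun1r.
Qed.

Lemma tensf0l V V' W W' (g : 'Hom(W, W')) : tensf (0 : 'Hom(V, V')) g = 0.
Proof. by rewrite -(scale0r 0) tensfZl scale0r. Qed.

Lemma tensf0r V V' W W' (f : 'Hom(V, V')) : tensf f (0 : 'Hom(W, W')) = 0.
Proof. by rewrite -(scale0r 0) tensfZr scale0r. Qed.

(** The vector v - projv B v is nonzero, hence so is one of its coordinates; that coordinate of u -
    projv B u, rescaled, is the functional. *)
Lemma separating_functional V (B : {vspace V}) (v : V) : v \notin B ->
  exists2 phi : dual V, phi v = 1 & forall b, b \in B -> phi b = 0.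
Proof.
move=> vB; pose w := v - projv B v.
have w0 : w != 0.
  by apply: contraNneq vB => /subr0_eq ->; apply: memv_proj.
have [i ci] : exists i, coord (vbasis fullv) i w != 0.
  apply/existsP; apply: contra_neqT w0 => /existsPn c0.
  rewrite (coord_vbasis (memvf w)) big1 // => i _.
  by move/eqP: (negbNE (c0 i)) => ->; rewrite scale0r.
pose c := coord (vbasis (@fullv k V)) i.
have cl : linear ((fun u => (c w)^-1 *: (c (u - projv B u) : k^o)) : V -> k^o).
  move=> a x y.
  have -> : a *: x + y - projv B (a *: x + y)
      = a *: (x - projv B x) + (y - projv B y).
    by rewrite linearD linearZ /= opprD addrACA scalerBr.
  move: (x - _) (y - _) => {}x {}y.
  rewrite /c linearP /=. by rewrite [LHS]mulrDr [X in X + _]mulrCA.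
exists (linfun (fun u => (c w)^-1 *: (c (u - projv B u) : k^o))).
  by rewrite linfunE // -/w; apply: mulVf.
by move=> b bB; rewrite linfunE // projv_id // subrr /c linear0 scaler0.
Qed.

End Evaluation.

Section TensorVertex.
Variables (Q : quiver) (k : fieldType) (R : set (pathalg Q k)).
Local Notation cplx := (cplx R).
Hypothesis hR : tensor_relations R.
Implicit Types (X Y Z : cplx) (i p q m n : int).

(** With e a generalized inverse of d, take s = e (1 - e d). By exactness v - e d v is a boundary,
    and d e fixes boundaries. *)
Lemma contraction X x : vertex_ideal x X ->
  exists s : forall i, 'Hom(X (i + 1) x, X i x), forall i,
    ((cdiff X i x \o s i) + (s (i + 1) \o cdiff X (i + 1) x) = \1)%VF.
Proof.
move/vertex_idealP=> Xx.
pose e i := (cdiff X i x)^-1%VF.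
have eK i u : cdiff X i x (e i (cdiff X i x u)) = cdiff X i x u.
  by rewrite /e limg_lfunVK // memv_img ?memvf.
exists (fun i => e i \o (\1 - (e (i + 1) \o cdiff X (i + 1) x)))%VF => i.
apply/lfunP=> v; rewrite add_lfunE !comp_lfunE !add_lfunE !opp_lfunE.
rewrite !comp_lfunE.
rewrite !id_lfunE cdiff2E !linear0 addr0.
have [|u uE] := Xx i (v - e (i + 1) (cdiff X (i + 1) x v)).
  by rewrite linearB /= eK subrr.
by rewrite uE eK -uE subrK.
Qed.

Lemma tout_tinE X Y p q p' q' n x : p' + q' = n ->
  (tout hR X Y p q n x \o tin hR X Y p' q' n x
   = tensf (rtransp X p' p x) (rtransp Y q' q x))%VF.
Proof.
by move=> pqn; have /= -> := (rhomP _ _).1 (tout_tin hR X Y p q pqn) x.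
Qed.

Lemma tin_diffE X Y p q n x : p + q = n ->
  (cdiff (ctens hR X Y) n x \o tin hR X Y p q n x
  = (tin hR X Y (p + 1) q (n + 1) x \o tensf (cdiff X p x) \1)
    + (-1) ^ p *:
      (tin hR X Y p (q + 1) (n + 1) x \o tensf \1 (cdiff Y q x)))%VF.
Proof.
by move=> pqn; have /= -> := (rhomP _ _).1 (tin_diff hR X Y pqn) x.
Qed.

Lemma rtens_out_at X Y p q n x (V : vectType k)
    (f g : 'Hom(tens (X p x) (Y q x), V)) :
  p + q = n -> (p, q) \notin bidegrees X Y n -> f = g.
Proof.
move=> pqn out; rewrite -(comp_lfun1r f) -(comp_lfun1r g).
have /= -> := (rhomP _ _).1 (rtens_out (ridh (rtens (X p) (Y q))) 0 pqn out) x.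
by rewrite !comp_lfun0r.
Qed.

(* At x the complex X is contractible, and a contraction s of X_x induces the
   contraction s ⊗ 1 of (X ⊗ Y)_x. *)
Lemma vertex_ideal_tens x X Y :
  vertex_ideal x X -> vertex_ideal x (ctens hR X Y).
Proof.
move=> Xx; have [s sE] := contraction Xx.
(* The map [s] is defined on degrees i + 1 only, so degree p is first transported to p - 1 + 1. *)
pose sg p : 'Hom(X p x, X (p - 1) x) :=
  (s (p - 1) \o rtransp X p (p - 1 + 1) x)%VF.
pose S m : 'Hom(ctens hR X Y (m + 1) x, ctens hR X Y m x) :=
  \sum_(a <- bidegrees X Y (m + 1))
    (tin hR X Y (a.1 - 1) a.2 m x \o tensf (sg a.1) \1
     \o tout hR X Y a.1 a.2 (m + 1) x)%VF.
have S_in i q m : i + 1 + q = m + 1 ->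
    (S m \o tin hR X Y (i + 1) q (m + 1) x
     = tin hR X Y i q m x \o tensf (s i) \1)%VF.
  move=> iqm.
  have [iqb|iqb] := boolP ((i + 1, q) \in bidegrees X Y (m + 1)); last first.
    exact: rtens_out_at iqb.
  apply/lfunP=> v; rewrite comp_lfunE sum_lfunE.
  rewrite (bigD1_seq (i + 1, q)) ?bidegrees_uniq //=.
  rewrite big1_seq ?addr0 => [|[p' q']].
    rewrite !comp_lfunE -[tout _ _ _ _ _ _ _ _]comp_lfunE tout_tinE //.
    rewrite -[LHS]comp_lfunE -[X in _ = X]comp_lfunE.
    rewrite !rtranspxx /= tensf_id id_lfunE /sg.
    (* With i + 1 - 1 generalised to a variable, the equation can be rewritten inside the dependent
       types. *)
    move: (i + 1 - 1) (addrK 1 i) => j ->.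
    by rewrite rtranspxx /= comp_lfun1r comp_lfunE.
  move=> /= /andP[ne _]; rewrite -comp_lfunE -comp_lfunA tout_tinE //.
  suff -> : tensf (rtransp X (i + 1) p' x) (rtransp Y q q' x) = 0.
    by rewrite comp_lfun0r zero_lfunE.
  move: ne; rewrite eq_sym xpair_eqE negb_and => /orP[] /rtransp_neq-> /=.
    exact: tensf0l.
  exact: tensf0r.
have SE m : ((cdiff (ctens hR X Y) m x \o S m)
    + (S (m + 1) \o cdiff (ctens hR X Y) (m + 1) x) = \1)%VF.
  apply: tin_ext_at; apply: int_surj_succ => i q iqm.
  have iq : i + q = m by apply: (addIr 1); rewrite addrAC.
  rewrite comp_lfunDl -!comp_lfunA tin_diffE // S_in //.
  rewrite comp_lfunA tin_diffE // comp_lfunDl comp_lfunDr.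
  rewrite -comp_lfunZl -comp_lfunZr !comp_lfunA.
  rewrite S_in; last by rewrite addrAC iqm.
  rewrite S_in; last by rewrite addrA iqm.
  rewrite -!comp_lfunA -!tensf_comp !comp_lfun1l !comp_lfun1r.
  (* The two terms s ⊗ d carry the signs (-1)^i and (-1)^(i+1) and cancel, leaving (d s + s d) ⊗
     1. *)
  rewrite expfzDr ?oppr_eq0 ?oner_eq0 // expr1z mulrN1 scaleNr.
  rewrite addrACA subrr addr0 -comp_lfunDr -tensfDl sE.
  by rewrite tensf_id comp_lfun1r.
apply/vertex_idealP => m t dt; exists (S m t).
have /lfunP/(_ t) := SE m.
by rewrite add_lfunE !comp_lfunE dt linear0 addr0 id_lfunE => ->.
Qed.


End TensorVertex.

Section Prime.
Variables (Q : quiver) (k : fieldType) (R : set (pathalg Q k)).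
Local Notation cplx := (cplx R).
Hypothesis hR : tensor_relations R.
Implicit Types (X Y Z : cplx) (i j p q m n : int).

(** A functional that kills boundaries and is 1 on [v] certifies a nonzero class in a form that
    passes to tensor products. *)
Lemma cohomology_class X x : ~ vertex_ideal x X ->
  exists i (v : X (i + 1) x) (phi : dual (X (i + 1) x)),
    [/\ cdiff X (i + 1) x v = 0, phi v = 1 & (phi \o cdiff X i x)%VF = 0].
Proof.
rewrite /vertex_ideal => /existsNP[i /negP/subvPn[v /cyclesP dv vB]].
have [phi phiv phiB] := separating_functional vB.
exists i, v, phi; split=> //; apply/lfunP=> u.
by rewrite comp_lfunE zero_lfunE phiB // memv_img ?memvf.
Qed.

Lemma transp_functional X i x V (phi : 'Hom(X (i + 1) x, V)) p :
  (phi \o cdiff X i x)%VF = 0 ->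
  (phi \o (rtransp X (p + 1) (i + 1) x \o cdiff X p x))%VF = 0.
Proof.
move=> phid; have [e|ne] := eqVneq (p + 1) (i + 1).
  have -> : p = i by apply: addIr e.
  by rewrite rtranspxx comp_lfun1l.
by rewrite rtransp_neq //= comp_lfun0l comp_lfun0r.
Qed.

(* If phi and psi detect the classes of v and w then phi ⊗ psi detects v ⊗ w. *)
Lemma vertex_ideal_prime x X Y :
  vertex_ideal x (ctens hR X Y) -> vertex_ideal x X \/ vertex_ideal x Y.
Proof.
move=> /vertex_idealP XYx; apply: contrapT => /not_orP[].
move=> /cohomology_class[i [v [phi [dv phiv phid]]]].
move=> /cohomology_class[j [w [psi [dw psiw psid]]]].
pose m := i + 1 + j.
have ijm : i + 1 + (j + 1) = m + 1 by rewrite addrA.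
have [|u tE] := XYx m (tin hR X Y (i + 1) (j + 1) (m + 1) x (ptens v w)).
  rewrite -comp_lfunE tin_diffE // add_lfunE scale_lfunE !comp_lfunE.
  rewrite !tensf_ptens dv dw ptens0l ptens0r.
  by rewrite !linear0 addr0.
(* [F] is phi ⊗ psi on the summand of bidegree (i + 1, j + 1) and zero on the others. Each Leibniz
   term then contains phi d or psi d, so [F] kills boundaries. *)
pose F := (psi \o tens_ev (Y (j + 1) x) phi
  \o tout hR X Y (i + 1) (j + 1) (m + 1) x)%VF.
have Fd : (F \o cdiff (ctens hR X Y) m x = 0)%VF.
  apply: tin_ext_at => p q pqm; rewrite comp_lfun0l -comp_lfunA tin_diffE //.
  rewrite comp_lfunDr -comp_lfunZr /F.
  have FE p' q' : p' + q' = m + 1 -> (psi \o tens_ev (Y (j + 1) x) phi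
     \o tout hR X Y (i + 1) (j + 1) (m + 1) x \o tin hR X Y p' q' (m + 1) x
     = psi \o tens_ev _ phi
       \o tensf (rtransp X p' (i + 1) x) (rtransp Y q' (j + 1) x))%VF.
    by move=> pq; rewrite -comp_lfunA tout_tinE.
  rewrite !comp_lfunA !FE; try by rewrite -?pqm ?addrA // addrAC.
  rewrite -!comp_lfunA -!tensf_comp !comp_lfun1r !tens_ev_tensf.
  rewrite (transp_functional _ phid) tens_ev0 !comp_lfun0r add0r.
  rewrite [X in _ *: X]comp_lfunA (transp_functional _ psid).
  by rewrite comp_lfun0l scaler0.
have : F (tin hR X Y (i + 1) (j + 1) (m + 1) x (ptens v w)) = 0.
  by rewrite tE -comp_lfunE Fd zero_lfunE.
rewrite /F !comp_lfunE -[tout _ _ _ _ _ _ _ _]comp_lfunE tout_tinE //.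
rewrite tensf_ptens tens_ev_ptens !rtranspxx /= !id_lfunE phiv scale1r psiw.
by apply/eqP/oner_neq0.
Qed.

End Prime.

(** * Complexes concentrated in one degree *)

Section Concentrated.
Variables (Q : quiver) (k : fieldType) (R : set (pathalg Q k)).
Local Notation cplx := (cplx R).
Implicit Types (X Y Z : cplx) (i p q n : int) (E F G : rep Q k).

(** With the degree test as a boolean argument, maps are defined by matching on it instead of
    transporting along equations of degrees. *)
Definition conc_ob (b : bool) E : rep Q k := if b then E else rzero Q k.

Definition conc_map b E F (f : rhom E F) : rhom (conc_ob b E) (conc_ob b F) :=
  if b as b return rhom (conc_ob b E) (conc_ob b F) then f else 0.

Definition conc_inj b E : rhom E (conc_ob b E) :=
  if b as b return rhom E (conc_ob b E) then ridh E else 0.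

Definition conc_proj b E : rhom (conc_ob b E) E :=
  if b as b return rhom (conc_ob b E) E then ridh E else 0.

Lemma conc_injK b E : conc_inj b E \oR conc_proj b E = ridh (conc_ob b E).
Proof.
case: b => /=; first by rewrite rcomp1l.
by apply/rhomP=> x; apply/lfunP=> v; apply/rowP; case.
Qed.

Lemma conc_projK (b : bool) E : b -> conc_proj b E \oR conc_inj b E = ridh E.
Proof. by case: b => //= _; rewrite rcomp1l. Qed.

Lemma conc_proj0 (b : bool) E : ~~ b -> conc_proj b E = 0.
Proof. by case: b. Qed.

Variables (p : int) (E : rep Q k) (hE : satisfies R E).

Program Definition conc : cplx :=
  @Cplx Q k R (fun i => conc_ob (i == p) E) (fun=> 0) _ _ _.
Next Obligation.
by rewrite /conc_ob; case: ifP => _ //; apply: satisfies_rzero.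
Qed.
Next Obligation. exact: rcomp0l. Qed.
Next Obligation.
exists (absz p) => i pi x; rewrite /conc_ob; case: eqP => [ip|_ v].
  by rewrite ip ltnn in pi.
by apply/rowP; case.
Qed.

Section Maps.
Variables (X : cplx) (f : rhom E (X p)) (g : rhom (X p) E).
Hypothesis df : cdiff X p \oR f = 0.
Hypothesis gd : forall i, g \oR rtransp X (i + 1) p \oR cdiff X i = 0.

Fact conc_to_subproof i :
  cdiff X i \oR (rtransp X p i \oR f \oR conc_proj (i == p) E)
  = rtransp X p (i + 1) \oR f \oR conc_proj (i + 1 == p) E \oR cdiff conc i.
Proof.
rewrite rcomp0r !rcompA; case: (p =P i) => [<-|/eqP ne].
  by rewrite rtranspxx rcomp1r df rcomp0l.
by rewrite (rtransp_neq _ ne) !(rcomp0r, rcomp0l).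
Qed.

Definition conc_to : cmap conc X :=
  @CMap Q k R conc X (fun i => _) conc_to_subproof.

(** For a general [p] the differential into degree [p] cannot be typed directly; [gd] ranges over
    all [i] and lets [rtransp] select the right one. *)
Fact conc_from_subproof i :
  cdiff conc i \oR (conc_inj (i == p) E \oR g \oR rtransp X i p)
  = conc_inj (i + 1 == p) E \oR g \oR rtransp X (i + 1) p \oR cdiff X i.
Proof. by rewrite rcomp0l -!rcompA (rcompA g) gd rcomp0r. Qed.

Definition conc_from : cmap X conc :=
  @CMap Q k R X conc (fun i => _) conc_from_subproof.

Lemma conc_from_to i : g \oR f = ridh E ->
  conc_from i \oR conc_to i = ridh (conc i).
Proof.
move=> gf /=; rewrite -conc_injK !rcompA -(rcompA _ (rtransp X i p)).
case: (p =P i) => [<-|/eqP ne]; last first.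
  by rewrite (@conc_proj0 (i == p)) ?rcomp0r // eq_sym.
by rewrite !rtranspxx !(rcomp1l, rcomp1r) -(rcompA (conc_inj _ _)) gf rcomp1r.
Qed.

End Maps.

Lemma vertex_ideal_conc x : vertex_ideal x conc <-> forall v : E x, v = 0.
Proof.
split=> [/vertex_idealP Cx v|E0].
  have C0 : forall i (u : conc i x), u = 0.
    by apply: int_surj_succ => i u; have [|w ->] := Cx i u; rewrite zero_lfunE.
  have /lfunP/(_ v) := (rhomP _ _).1 (conc_projK E (eqxx p)) x.
  by rewrite /= comp_lfunE id_lfunE (C0 p (conc_inj _ _ x v)) linear0.
apply/vertex_idealP=> i /= v _; exists 0; rewrite linear0.
by move: v; rewrite /conc_ob; case: ifP => _ v; [exact: E0 | apply/rowP; case].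
Qed.

End Concentrated.

(** * Indicator representations *)

Section Indicator.
Variable k : fieldType.
Implicit Types b : bool.

(* A boolean coerces to 0 or 1, so 'rV[k]_b is k or 0; const_mx 1 is then the
   identity of k, or 0. *)
Definition indmap b b' : 'Hom('rV[k]_b, 'rV[k]_b') :=
  linfun (mulmxr (const_mx 1)).

Lemma indmapE b b' v : indmap b b' v = v *m const_mx 1.
Proof. by rewrite lfunE. Qed.

Lemma indmap_id b : indmap b b = \1%VF.
Proof.
apply/lfunP=> v; rewrite indmapE id_lfunE; case: b v => v; last first.
  by rewrite [v]thinmx0 mul0mx.
by apply/rowP=> j; rewrite mxE big_ord1 mxE mulr1 !ord1.
Qed.

(** The hypothesis excludes k -> 0 -> k, the one case where the composite differs. *)
Lemma indmap_comp b1 b2 b3 : b1 && b3 ==> b2 ->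
  (indmap b2 b3 \o indmap b1 b2)%VF = indmap b1 b3.
Proof.
move=> b123; apply/lfunP=> v; rewrite comp_lfunE !indmapE -mulmxA.
case: b1 b3 b123 v => [] [] //= b123 v; last 3 first.
- by rewrite [LHS]thinmx0 [RHS]thinmx0.
- by rewrite [v]thinmx0 !mul0mx.
- by rewrite [LHS]thinmx0 [RHS]thinmx0.
case: b2 b123 => // _; congr (_ *m _); apply/matrixP=> i j.
by rewrite !mxE big_ord1 !mxE mulr1.
Qed.

Lemma indmap0 b b' : ~~ (b && b') -> indmap b b' = 0.
Proof.
move=> bb'; apply/lfunP=> v; rewrite zero_lfunE indmapE.
case: b b' bb' v => [] [] //= _ v; try by rewrite [v]thinmx0 mul0mx.
by rewrite [LHS]thinmx0.
Qed.

Definition indsum b : dual 'rV[k]_b :=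
  linfun (fun v : 'rV[k]_b => \sum_j v 0 j : k^o).

Lemma indsumE b v : indsum b v = \sum_j v 0 j.
Proof.
apply: linfunE => c x y; rewrite scaler_sumr -big_split /=.
by apply: eq_bigr => j _; rewrite !mxE.
Qed.

Lemma indsum_umap b b' : b ==> b' -> (indsum b' \o indmap b b')%VF = indsum b.
Proof.
move=> bb'; apply/lfunP=> v; rewrite comp_lfunE indmapE !indsumE.
case: b bb' v => /= [|_ v]; last first.
  by rewrite [v]thinmx0 mul0mx !big1 // => j _; rewrite mxE.
case: b' => // _ v; rewrite !big_ord1 mxE big_ord1 mxE mulr1.
by rewrite !ord1.
Qed.

Lemma indsum_inj b v : indsum b v = 0 -> v = 0.
Proof.
rewrite indsumE; case: b v => v; last by rewrite [v]thinmx0.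
by rewrite big_ord1 => v0; apply/rowP=> j; rewrite ord1 v0 mxE.
Qed.

Lemma indsum_const : indsum true (const_mx 1) = 1.
Proof. by rewrite indsumE big_ord1 mxE. Qed.

End Indicator.

Section IndicatorRep.
Variables (Q : quiver) (k : fieldType).
Implicit Types (A B : {set vert Q}) (V W : rep Q k).

(** For successor-closed [A] this is the subrepresentation of the unit supported on [A]. *)
Definition rind A : rep Q k :=
  @Rep Q k (fun x => 'rV[k]_(x \in A))
    (fun a => indmap k (src a \in A) (tgt a \in A)).

(** The semisimple representation that is the direct sum of the S_n for n in [B]. *)
Definition rdisc B : rep Q k := @Rep Q k (fun x => 'rV[k]_(x \in B)) (fun=> 0).

Definition succ_closed A := forall a, src a \in A -> tgt a \in A.

Lemma satisfies_inj (R : set (pathalg Q k)) V W (f : rhom V W) :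
  (forall x v, f x v = 0 -> v = 0) -> satisfies R W -> satisfies R V.
Proof.
move=> finj WR r Rr x y; apply/lfunP=> v; rewrite zero_lfunE.
by apply: (finj y); rewrite -comp_lfunE act_nat WR // comp_lfun0l zero_lfunE.
Qed.

Program Definition rind_runit A (clA : succ_closed A) :
    rhom (rind A) (runit Q k) :=
  @RHom Q k (rind A) (runit Q k) (fun x => indsum k (x \in A)) _.
Next Obligation.
by rewrite comp_lfun1l /= indsum_umap //; apply/implyP; apply: clA.
Qed.

Lemma satisfies_rind R A :
  tensor_relations R -> succ_closed A -> satisfies R (rind A).
Proof.
move=> [_ R1 _] clA; apply: (satisfies_inj (f := rind_runit clA)) R1.
by move=> x v; apply: indsum_inj.
Qed.

Lemma satisfies_rdisc R B : tensor_relations R -> satisfies R (rdisc B).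
Proof.
move=> [Rnt _ _] r /Rnt{}Rnt x y; rewrite /act big_seq big1 // => p /Rnt.
rewrite /nontrivial; case: (val p).2 => //= a s _.
by rewrite comp_lfun0r !comp_lfun0l scaler0.
Qed.

(* A vertex of A that reaches as many vertices as possible is a source of A. *)
Lemma source_exists A : ordered_quiver Q -> A != finset.set0 ->
  exists2 n, n \in A & forall a, src a \in A -> tgt a != n.
Proof.
move=> hQ /finset.set0Pn[n0 n0A].
pose e : rel (vert Q) := fun x y => [exists a, (src a == x) && (tgt a == y)].
have walk_of x p : path e x p -> exists2 s, walk x s & walk_end x s = last x p.
  elim: p x => [|y p IHp] x /=; first by exists [::].
  case/andP=> /existsP[a /andP[/eqP ax /eqP ay]] /IHp[s sw se].
  by exists (a :: s); rewrite /= ?ax ?ay ?eqxx // /walk_end /= ay.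
case: (arg_maxnP (fun n => #|connect e n|) n0A) => n nA nmax.
exists n => // a aA; apply/eqP => an.
(* The source of an arrow into n reaches everything that n reaches and also itself, which n cannot
   reach without closing an oriented cycle; this contradicts maximality. *)
have ean : e (src a) n by apply/existsP; exists a; rewrite an !eqxx.
have := nmax _ aA; rewrite /= leqNgt => /negP; apply; apply: proper_card.
apply/properP; split.
  apply/fintype.subsetP=> y; rewrite !inE.
  exact: connect_trans (connect1 ean).
exists (src a); first by rewrite inE connect0.
apply/negP => /connectP[p /walk_of[s sw se] lp].
have : walk_end (src a) (a :: s) != src a by apply: hQ; rewrite //= eqxx an.
by rewrite /walk_end /= an -[last _ _]/(walk_end n s) se -lp eqxx.
Qed.

End IndicatorRep.

(** * Generation by the simple representations *)

Section Spectrum.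
Variables (Q : quiver) (k : fieldType) (R : set (pathalg Q k)).
Local Notation cplx := (cplx R).
Hypothesis hR : tensor_relations R.
Implicit Types (X Y Z V W : cplx) (i p q m : int) (E F G : rep Q k).
Implicit Types (A B : {set vert Q}) (n x : vert Q).

Definition conc_cmap p E F (hE : satisfies R E) (hF : satisfies R F)
    (f : rhom E F) : cmap (conc p hE) (conc p hF) :=
  @CMap Q k R (conc p hE) (conc p hF) (fun i => conc_map (i == p) f)
    (fun i => etrans (rcomp0l _ _) (esym (rcomp0r _ _))).

Lemma conc_ses p E F G (hE : satisfies R E) (hF : satisfies R F)
    (hG : satisfies R G) (f : rhom E F) (g : rhom F G) :
  (forall x, [/\ forall v, f x v = 0 -> v = 0, forall v, g x (f x v) = 0,
     forall y, g x y = 0 -> exists v, y = f x v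
   & forall z, exists y, z = g x y]) ->
  ses (conc_cmap p hE hF f) (conc_cmap p hF hG g).
Proof.
move=> fg i x /=; rewrite /conc_ob /conc_map; case: (i == p); first exact: fg.
by split=> [v _|v|y _|z]; try exists 0; apply: rzero_eq.
Qed.

(* Deleting from A a vertex n that no arrow from A enters leaves a
   subrepresentation with quotient S_n. *)
Lemma rind_in_ideal (J : subcat R) : ordered_quiver Q -> thick_triangulated J ->
  (forall n, J (conc 0 (satisfies_rdisc [set n] hR))) ->
  forall A (hA : satisfies R (rind k A)), succ_closed A -> J (conc 0 hA).
Proof.
move=> hQ tJ JS A; elim: {A}_.+1 {-2}A (ltnSn #|A|) => // N IHN A ltAN hA clA.
have [A0|A0] := eqVneq A finset.set0.
  apply: thick_acyclic => // x; apply/vertex_ideal_conc => /=.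
  by rewrite A0 inE => v; apply/rowP; case.
have [n nA nsrc] := source_exists hQ A0.
have clAn : succ_closed (A :\ n).
  move=> a; rewrite !inE => /andP[_ aA]; rewrite nsrc //=.
  exact: clA.
have hAn := satisfies_rind hR clAn.
have fP a : (rarr (rind k A) a \o indmap k (src a \in A :\ n) (src a \in A)
    = indmap k (tgt a \in A :\ n) (tgt a \in A) \o rarr (rind k (A :\ n)) a)%VF.
  rewrite /= !indmap_comp //; apply/implyP.
    by case/andP=> /clAn.
  by rewrite in_setD1 => /andP[/andP[]].
have gP a :
  (rarr (rdisc k [set n]) a \o indmap k (src a \in A) (src a \in [set n])
    = indmap k (tgt a \in A) (tgt a \in [set n]) \o rarr (rind k A) a)%VF.
  rewrite /= comp_lfun0l indmap_comp; last by apply/implyP=> /andP[/clA].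
  rewrite indmap0 // inE; have [aA|//] := boolP (src a \in A).
  by rewrite (negbTE (nsrc a aA)).
pose f := @RHom Q k (rind k (A :\ n)) (rind k A) (fun x => indmap k _ _) fP.
pose g := @RHom Q k (rind k A) (rdisc k [set n]) (fun x => indmap k _ _) gP.
apply: (thick_ses tJ (f := conc_cmap 0 hAn hA f)
  (g := conc_cmap 0 hA (satisfies_rdisc [set n] hR) g)) => //; last first.
  by apply: IHN => //; move: ltAN; rewrite (cardsD1 n A) nA.
apply: conc_ses => x /=; rewrite !inE; have [->|xn] /= := eqVneq x n.
  rewrite nA; split=> [v _|v|y|z].
  - by rewrite [v]thinmx0.
  - by rewrite [v]thinmx0 !linear0.
  - by rewrite indmap_id id_lfunE => ->; exists 0; rewrite linear0.
  - by exists z; rewrite indmap_id id_lfunE.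
split=> [v|v|y _|z].
- by rewrite indmap_id id_lfunE.
- by rewrite [LHS]thinmx0.
- by exists y; rewrite indmap_id id_lfunE.
- by exists 0; rewrite [LHS]thinmx0 [RHS]thinmx0.
Qed.

Local Notation rfull := (rind k [set: vert Q]).

Lemma rind_arr1 (a : arr Q) :
  indmap k (src a \in [set: vert Q]) (tgt a \in [set: vert Q]) (const_mx 1)
  = const_mx 1.
Proof.
rewrite indmapE; apply/rowP=> j; rewrite !mxE.
by rewrite !inE /= big_ord1 !mxE mulr1.
Qed.

Fact unit_in_nat E a :
  (rarr (rtens rfull E) a
     \o ptensr (E (src a)) (const_mx 1 : rfull (src a))
  = ptensr (E (tgt a)) (const_mx 1 : rfull (tgt a)) \o rarr E a)%VF.
Proof.
by apply/lfunP=> v; rewrite !comp_lfunE !ptensrE /= tensf_ptens rind_arr1.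
Qed.

Definition unit_in E : rhom E (rtens rfull E) :=
  @RHom Q k E (rtens rfull E) (fun x => ptensr (E x) (const_mx 1))
    (@unit_in_nat E).

Fact unit_out_nat E a :
  (rarr E a \o tens_ev (E (src a)) (indsum k (src a \in [set: vert Q]))
   = tens_ev (E (tgt a)) (indsum k (tgt a \in [set: vert Q]))
       \o rarr (rtens rfull E) a)%VF.
Proof. by rewrite tens_ev_tensf indsum_umap // !inE. Qed.

Definition unit_out E : rhom (rtens rfull E) E :=
  @RHom Q k (rtens rfull E) E (fun x => tens_ev (E x) (indsum k _))
    (@unit_out_nat E).

Lemma unit_out_in E : unit_out E \oR unit_in E = ridh E.
Proof.
apply/rhomP=> x; apply/lfunP=> v; rewrite /= comp_lfunE ptensrE.
rewrite tens_ev_ptens id_lfunE.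
have -> : indsum k (x \in [set: vert Q]) (const_mx 1) = 1.
  by rewrite inE indsum_const.
exact: scale1r.
Qed.

Lemma unit_inN E F (f : rhom E F) :
  rtensh (ridh rfull) f \oR unit_in E = unit_in F \oR f.
Proof.
apply/rhomP=> x; apply/lfunP=> v; rewrite /= !comp_lfunE !ptensrE.
by rewrite tensf_ptens id_lfunE.
Qed.

Lemma unit_outN E F (f : rhom E F) :
  unit_out F \oR rtensh (ridh rfull) f = f \oR unit_out E.
Proof. by apply/rhomP=> x /=; rewrite tens_ev_tensf comp_lfun1r. Qed.

Definition conc_in p E (hE : satisfies R E) : rhom E (conc p hE p) :=
  conc_inj (p == p) E.

Definition conc_out p E (hE : satisfies R E) : rhom (conc p hE p) E :=
  conc_proj (p == p) E.

Lemma conc_inK p E (hE : satisfies R E) :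
  conc_out p hE \oR conc_in p hE = ridh E.
Proof. exact/conc_projK/eqxx. Qed.

(** * The unit generates: V as a retract of U ⊗ V *)

Section UnitRetract.
Variables (h1 : satisfies R rfull) (V : cplx).
Local Notation U := (conc 0 h1).
Local Notation UV := (ctens hR U V).

Definition unit_to i : rhom (V i) (UV i) :=
  tin hR U V 0 i i \oR rtensh (conc_in 0 h1) (ridh (V i)) \oR unit_in (V i).

Fact unit_to_subproof i :
  cdiff UV i \oR unit_to i = unit_to (i + 1) \oR cdiff V i.
Proof.
rewrite /unit_to !rcompA tin_diff ?add0r //.
rewrite rtens0h rcomp0r add0r expr0z scale1r -!rcompA -unit_inN !rcompA.
by rewrite -!(rcompA (tin _ _ _ _ _ _)) -!rtensh_comp !rcomp1l !rcomp1r.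
Qed.

Definition unit_from i : rhom (UV i) (V i) :=
  unit_out (V i) \oR rtensh (conc_out 0 h1) (ridh (V i)) \oR tout hR U V 0 i i.

Fact unit_from_subproof i :
  cdiff V i \oR unit_from i = unit_from (i + 1) \oR cdiff UV i.
Proof.
apply: tin_ext => p q pqi; rewrite /unit_from -!rcompA tin_diff //.
rewrite rtens0h rcomp0r add0r !rcompZr tout_tin // (rcompA (tout _ _ _ _ _ _)).
rewrite tout_tin ?addrA ?pqi // -!rtensh_comp !rcomp1l !rcomp1r.
rewrite rcompA -unit_outN -rcompA -rtensh_comp rcomp1l.
(* Only summands with [U] in degree 0 contribute; there the Leibniz sign is (-1)^0. *)
case: (p =P 0) => [p0|/eqP p0]; last first.
  by rewrite (rtransp_neq _ p0) !rtens0h !rcomp0r scaler0.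
have <- : q = i by rewrite -pqi p0 add0r.
by rewrite p0 expr0z scale1r !rtranspxx rcomp1r rcomp1l.
Qed.

Lemma unit_from_to i : unit_from i \oR unit_to i = ridh (V i).
Proof.
rewrite /unit_from /unit_to !rcompA -(rcompA _ (tout _ _ _ _ _ _)).
rewrite tout_tin ?add0r // !rtranspxx rtensh_id rcomp1r.
by rewrite !rcomp1r; exact: unit_out_in.
Qed.

Lemma unit_ideal (J : subcat R) : tensor_ideal hR J -> J U -> J V.
Proof.
case=> tJ JT /(JT _ V).
apply: (thick_retract tJ (f := @CMap Q k R V UV unit_to unit_to_subproof)
  (g := @CMap Q k R UV V unit_from unit_from_subproof)).
exact: unit_from_to.
Qed.

End UnitRetract.

End Spectrum.

(** * Simple representations detected by nonzero cohomology *)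

Section SimpleRetract.
Variables (Q : quiver) (k : fieldType) (R : set (pathalg Q k)).
Hypothesis hR : tensor_relations R.
Variables (n : vert Q) (V : cplx R) (i : int).
Variables (v : V (i + 1) n) (phi : dual (V (i + 1) n)).
Hypotheses (dv : cdiff V (i + 1) n v = 0) (phiv : phi v = 1).
Hypothesis phid : (phi \o cdiff V i n)%VF = 0.
Local Notation p := (i + 1).
Local Notation S := (rdisc k [set n]).
Local Notation hS := (satisfies_rdisc [set n] hR).
Local Notation Y := (conc (- p) hS).
Local Notation VY := (ctens hR V Y).

Lemma transpxx (F : vert Q -> vectType k) x : transp F x x = \1%VF.
Proof. by rewrite /transp; case: eqP => // e; rewrite eq_axiomK. Qed.

(** Every arrow acts as zero on S_n and on V^p ⊗ S_n, so a vector or a functional at [n] alone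
    defines a morphism. *)
Fact simple_in_subproof a :
  (rarr (rtens (V p) S) a \o ptensr (S (src a)) (transp (V p) n (src a) v)
   = ptensr (S (tgt a)) (transp (V p) n (tgt a) v) \o rarr S a)%VF.
Proof. by rewrite /= tensf0r comp_lfun0l comp_lfun0r. Qed.

Definition simple_in : rhom S (rtens (V p) S) :=
  @RHom Q k S (rtens (V p) S) (fun x => ptensr (S x) (transp (V p) n x v))
    simple_in_subproof.

Fact simple_out_subproof a :
  (rarr S a \o tens_ev (S (src a)) (phi \o transp (V p) (src a) n)
   = tens_ev (S (tgt a)) (phi \o transp (V p) (tgt a) n)
       \o rarr (rtens (V p) S) a)%VF.
Proof. by rewrite /= tensf0r comp_lfun0l comp_lfun0r. Qed.

Definition simple_out : rhom (rtens (V p) S) S :=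
  @RHom Q k (rtens (V p) S) S
    (fun x => tens_ev (S x) (phi \o transp (V p) x n)%VF) simple_out_subproof.

Lemma simple_out_in : simple_out \oR simple_in = ridh S.
Proof.
apply/rhomP=> x; apply/lfunP=> s.
rewrite /= comp_lfunE ptensrE tens_ev_ptens id_lfunE.
case: (x =P n) s => [->|/eqP xn] s; last first.
  move: s; rewrite /= inE (negbTE xn) => s.
  by rewrite [LHS]thinmx0 [RHS]thinmx0.
by rewrite comp_lfunE !transpxx !id_lfunE phiv scale1r.
Qed.

Lemma diff_simple_in F (f : rhom S F) : rtensh (cdiff V p) f \oR simple_in = 0.
Proof.
apply/rhomP=> x; apply/lfunP=> s; rewrite /= comp_lfunE ptensrE tensf_ptens.
rewrite -[cdiff V _ x _]comp_lfunE transp_nat comp_lfunE dv linear0 ptens0l.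
by rewrite zero_lfunE.
Qed.

Lemma simple_out_diff j F (f : rhom F S) :
  simple_out \oR rtensh (rtransp V (j + 1) p \oR cdiff V j) f = 0.
Proof.
apply/rhomP=> x; rewrite /= tens_ev_tensf.
have /= -> : (phi \o transp (V p) x n
    \o (rtransp V (j + 1) p \oR cdiff V j) x = 0)%VF.
  rewrite -comp_lfunA -transp_nat comp_lfunA transp_functional //.
  exact: comp_lfun0l.
by rewrite tens_ev0 comp_lfun0r.
Qed.

(** S_n is placed in degree -p so that V^p ⊗ S_n sits in degree 0. *)
Definition simple_to : rhom S (VY 0) :=
  tin hR V Y p (- p) 0 \oR rtensh (ridh (V p)) (conc_in (- p) hS) \oR simple_in.

Lemma simple_to_diff : cdiff VY 0 \oR simple_to = 0.
Proof.
rewrite /simple_to !rcompA tin_diff ?subrr // rtensh0 rcomp0r scaler0 addr0.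
rewrite -!rcompA (rcompA (rtensh _ _)) -rtensh_comp rcomp1r rcomp1l.
by rewrite diff_simple_in rcomp0r.
Qed.

(** The free degree [m] lets the map absorb the transport from j + 1 to 0 when j + 1 = 0. *)
Definition simple_from m : rhom (VY m) S :=
  simple_out \oR rtensh (ridh (V p)) (conc_out (- p) hS)
    \oR tout hR V Y p (- p) m.

Lemma simple_from_diff j :
  simple_from 0 \oR rtransp VY (j + 1) 0 \oR cdiff VY j = 0.
Proof.
case: (j + 1 =P 0) => [j0|/eqP j0]; last first.
  by rewrite (rtransp_neq _ j0) rcomp0r rcomp0l.
have -> : simple_from 0 \oR rtransp VY (j + 1) 0 = simple_from (j + 1).
  by rewrite j0 rtranspxx rcomp1r.
apply: tin_ext => p' q' pq; rewrite rcomp0l -rcompA tin_diff // rtensh0 rcomp0r.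
rewrite scaler0 addr0 /simple_from -!rcompA (rcompA (tout _ _ _ _ _ _)).
rewrite tout_tin; last by rewrite addrAC pq.
rewrite -rtensh_comp rcomp1r -rtensh_comp rcomp1l; exact: simple_out_diff.
Qed.

(** The maps s |-> v ⊗ s and phi ⊗ 1 exhibit the retract; they are chain maps by d v = 0 and phi d =
    0. *)
Lemma simple_ideal (J : subcat R) : tensor_ideal hR J -> J V -> J (conc 0 hS).
Proof.
case=> tJ JT /(JT _ Y).
apply: (thick_retract tJ (f := conc_to hS simple_to_diff)
  (g := conc_from hS simple_from_diff)) => j.
apply: conc_from_to; rewrite /simple_from /simple_to !rcompA.
rewrite -(rcompA _ (tout _ _ _ _ _ _)) tout_tin ?subrr //.
rewrite !rtranspxx rtensh_id rcomp1r.
rewrite -(rcompA simple_out) -rtensh_comp conc_inK rcomp1l rtensh_id rcomp1r.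
exact: simple_out_in.
Qed.

End SimpleRetract.

(** * The spectrum *)

Section Main.
Variables (Q : quiver) (k : fieldType) (R : set (pathalg Q k)).
Hypothesis hR : tensor_relations R.
Implicit Types (n x : vert Q).
Local Notation S n := (conc 0 (satisfies_rdisc [set n] hR)).

Lemma vertex_ideal_rdisc x (B : {set vert Q}) :
  vertex_ideal x (conc 0 (satisfies_rdisc B hR)) <-> x \notin B.
Proof.
apply: (iff_trans (vertex_ideal_conc _ _ _)) => /=; case: (x \in B); split=> //.
  by move=> /(_ (const_mx 1))/rowP/(_ 0)/eqP; rewrite !mxE oner_eq0.
by move=> _ v; rewrite [LHS]thinmx0.
Qed.

Lemma vertex_ideal_is_prime n : Spc hR (@vertex_ideal Q k R n).
Proof.
split.
- by split; [exact: vertex_ideal_thick | move=> V W; apply: vertex_ideal_tens].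
- by exists (S n); rewrite vertex_ideal_rdisc inE eqxx.
- exact: vertex_ideal_prime.
Qed.

Lemma prime_vertex_ideal (P : subcat R) : ordered_quiver Q -> Spc hR P ->
  exists n, P = @vertex_ideal Q k R n.
Proof.
move=> hQ [[tP PT] [W PW] Pprime].
have [n Pn] : exists n, ~ P (S n).
  apply/not_existsP=> PS; apply: PW.
  have cl : succ_closed [set: vert Q] by move=> a; rewrite !inE.
  apply: (unit_ideal (hR := hR) (h1 := satisfies_rind hR cl)); first by split.
  by apply: (rind_in_ideal hQ tP) => // n; apply: contrapT; apply: PS.
exists n; apply: funext => V; apply/propext; split=> [PV|Vn].
  apply: contrapT => /cohomology_class[i [v [phi [dv phiv phid]]]].
  by apply: Pn; apply: (simple_ideal (hR := hR) dv phiv phid).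
suff PVS : P (ctens hR V (S n)) by have [] := Pprime _ _ PVS.
apply: thick_acyclic => // x; have [->|xn] := eqVneq x n.
  exact: vertex_ideal_tens.
apply/vertex_idealP => i t _; exists 0; rewrite linear0.
pose T := ctens hR V (S n) (i + 1) x.
(* At x different from n every summand V^p ⊗ S_n^q vanishes, so the identity of [T] agrees with 0 on
   each of them. *)
suff id0 : \1%VF = 0 :> 'Hom(T, T).
  by rewrite -[t]id_lfunE id0 zero_lfunE.
apply: tin_ext_at => p q _; rewrite comp_lfun1l comp_lfun0l.
apply/lfunP=> s; rewrite zero_lfunE.
suff -> : s = 0 by rewrite linear0.
apply/lfunP=> psi; rewrite zero_lfunE.
move: (X in X = 0); rewrite /= /conc_ob /=; case: ifP => _ /= w.
  by move: w; rewrite inE (negbTE xn) => w; rewrite [LHS]thinmx0.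
by apply/rowP; case.
Qed.

End Main.

Theorem theorem2p1p5p1 (k : fieldType) (Q : quiver) (hQ : ordered_quiver Q)
    (R : set (pathalg Q k)) (hR : tensor_relations R) :
  (forall P : subcat R, Spc hR P <-> exists n : vert Q, P = vertex_ideal n)
  /\ Spc_discrete hR.
Proof.
have SpcE P : Spc hR P <-> exists n : vert Q, P = vertex_ideal n.
  by split=> [/(prime_vertex_ideal hQ)//|[n ->]]; apply: vertex_ideal_is_prime.
split=> // A AS; split=> //.
(* Openness of [A] asks for its complement to be closed, so [B] collects the vertices whose prime
   lies outside [A]. *)
pose B := [set n | `[< ~ A (vertex_ideal n) >]]%SET.
exists (fun V => V = conc 0 (satisfies_rdisc B hR)) => P.
have PB : Spc hR P -> ~ A P <-> ~ P (conc 0 (satisfies_rdisc B hR)).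
  case/SpcE=> n ->; rewrite vertex_ideal_rdisc inE.
  split=> [nA|/negP]; [apply/negP|]; rewrite negbK; first exact/asboolP.
  by move/asboolP.
by split=> -[SP H]; split=> //; [move=> _ -> |]; apply/(PB SP) => //; apply: H.
Qed.
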